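(* Let $T: L_1(\nabla,m)\to L_1(\nabla,m)$ be an $L_0(\Omega)$-bounded linear operator. Then there exists a unique $L_0(\Omega)$-bounded linear operator $|T|: L_1(\nabla,m)\to L_1(\nabla,m)$ such that: (a) $\|T\|=\big\||T|\big\|$; (b) $|T\hat f|\le |T|\,|\hat f|$ for all $\hat f\in L_1(\nabla,m)$; (c) for every $\hat f\in L_1(\nabla,m)$ with $\hat f\ge 0$, $|T|\hat f=\sup\{|T\hat g|:\ \hat g\in L_1(\nabla,m),\ |\hat g|\le \hat f\}$ (supremum in the lattice $L_1(\nabla,m)$). Moreover, (d) if $T$ maps $L_\infty(\nabla,m)$ into itself with $\|T\|_\infty<\infty$, then $\|T\|_\infty=\big\||T|\big\|_\infty$.
   Context: Let $(\Omega,\Sigma,\mu)$ be a complete finite measure space and $L_0(\Omega)$ the algebra of classes of a.e. equal real measurable functions on $\Omega$, ordered by $f\le g$ iff $f\le g$ a.e., with unit $\mathbf 1$; it is a Dedekind complete vector lattice, and $(o)$-convergence denotes order convergence in it. Let $\nabla$ be a complete Boolean algebra, $X(\nabla)$ its Stone space, and $L_0(\nabla)$ the algebra of continuous functions $X(\nabla)\to[-\infty,+\infty]$ taking the values $\pm\infty$ only on nowhere dense sets. An $L_0(\Omega)$-valued measure is a map $m:\nabla\to L_0(\Omega)$ with $m(e)\ge 0$, $m(e)=0\iff e=0$; $m(e\vee g)=m(e)+m(g)$ when $e\wedge g=0$; and $m(e_\alpha)\downarrow 0$ whenever $e_\alpha\downarrow 0$. It is assumed $d$-decomposable: for each $e\in\nabla$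 and each decomposition $m(e)=a_1+a_2$ with $a_1,a_2\ge 0$ disjoint in $L_0(\Omega)$ there are $e_1,e_2\in\nabla$ with $e=e_1\vee e_2$ and $m(e_i)=a_i$. For $p\ge1$, $L_p(\nabla,m)=\{f\in L_0(\nabla): \int|f|^p\,dm \text{ exists}\}$ with $L_0(\Omega)$-valued norm $|f|_p=(\int|f|^p\,dm)^{1/p}$; it is a Banach–Kantorovich lattice (a vector lattice and $L_0(\Omega)$-module, monotone norm, $|\alpha f|_p=|\alpha||f|_p$ for $\alpha\in L_0(\Omega)$, complete w.r.t. $(bo)$-convergence: $f_\alpha\to f$ iff $|f_\alpha-f|_p\to0$ in order in $L_0(\Omega)$). $L_\infty(\nabla,m):=C(X(\nabla))\subset L_p(\nabla,m)$. For $\hat f\in L_\infty(\nabla,m)$ put $\|\hat f\|_\infty=\inf\{\lambda\ge0: |\hat f|\le\lambda\mathbf 1\}$, and for an operator $T$ leaving $L_\infty(\nabla,m)$ invariant put $\|T\|_\infty=\sup\{\|T\hat f\|_\infty:\hat f\in L_\infty(\nabla,m),\ \|\hat f\|_\infty\le1\}$. A linear $T:L_p(\nabla,m)\to L_p(\nabla,m)$ is $L_0(\Omega)$-bounded if there is $k\in L_0(\Omega)$ with $|T\hat f|_p\le k|\hat f|_p$ for all $\hat f$; its $L_0(\Omega)$-valued norm is $\|T\|=\sup_{|\hat f|_p\le\mathbf 1}|T\hat f|_p\in L_0(\Omega)$. *)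

(* Defs.v *)
From HB Require Import structures.
From mathcomp Require Import all_boot all_order all_algebra.
From mathcomp Require Import all_classical all_reals all_analysis.
Set Implicit Arguments. Unset Strict Implicit. Unset Printing Implicit Defensive.
Import Order.TTheory GRing.Theory Num.Theory.
Import numFieldNormedType.Exports.
Local Open Scope classical_set_scope.
Local Open Scope ring_scope.

Section BooleanAlgebra.
Context {disp : Order.disp_t} (B : ctbDistrLatticeType disp).

Definition BA_lub (A : set B) (s : B) : Prop :=
  (forall x, A x -> (x <= s)%O) /\ (forall u, (forall x, A x -> (x <= u)%O) -> (s <= u)%O).
Definition BA_glb (A : set B) (s : B) : Prop :=
  (forall x, A x -> (s <= x)%O) /\ (forall u, (forall x, A x -> (u <= x)%O) -> (u <= s)%O).
Definition complete_BA : Prop := forall A : set B, exists s, BA_lub A s.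

(* Stone space X(nabla): ultrafilters of nabla, with the topology whose   *)
(* base is the clopen sets U e = {p | e \in p}.                            *)
Definition is_ultrafilter (F : set B) : Prop :=
  [/\ ~ F \bot%O, F \top%O,
      (forall x y, F x -> (x <= y)%O -> F y),
      (forall x y, F x -> F y -> F (Order.meet x y)) &
      (forall x, F x \/ F (Order.compl x))].

Definition stone := {F : set B | is_ultrafilter F}.
Definition Ubase (e : B) : set stone := [set p | proj1_sig p e].

Definition nowhere_dense (A : set stone) : Prop :=
  forall e, Ubase e !=set0 ->
    exists e', [/\ Ubase e' !=set0, Ubase e' `<=` Ubase e & Ubase e' `&` A = set0].
End BooleanAlgebra.

Section L0nabla.
Context (R : realType) {disp : Order.disp_t} (B : ctbDistrLatticeType disp).
Local Open Scope ereal_scope.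

Definition stone_continuous (f : stone B -> \bar R) : Prop :=
  forall p N, nbhs (f p) N -> exists e, Ubase e p /\ (forall q, Ubase e q -> N (f q)).

Definition isL0 (f : stone B -> \bar R) : Prop :=
  stone_continuous f /\ nowhere_dense [set p | f p = +oo \/ f p = -oo].

Definition L0n := {f : stone B -> \bar R | isL0 f}.

(* The operations of L_0(nabla): the (unique) element of L_0(nabla) that  *)
(* agrees with the pointwise operation where the arguments are finite.    *)
Definition L0_choose (P : L0n -> Prop) (dflt : L0n) : L0n :=
  match pselect (exists h, P h) with
  | left H => proj1_sig (cid H)
  | right _ => dflt end.

Definition L0add (f g : L0n) : L0n :=
  L0_choose (fun h => forall p, proj1_sig f p \is a fin_num ->
     proj1_sig g p \is a fin_num -> proj1_sig h p = proj1_sig f p + proj1_sig g p) f.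
Definition L0scale (r : R) (f : L0n) : L0n :=
  L0_choose (fun h => forall p, proj1_sig f p \is a fin_num ->
     proj1_sig h p = r%:E * proj1_sig f p) f.
Definition L0abs (f : L0n) : L0n :=
  L0_choose (fun h => forall p, proj1_sig h p = `| proj1_sig f p |) f.
Definition L0le (f g : L0n) : Prop := forall p, proj1_sig f p <= proj1_sig g p.
Definition L0nonneg (f : L0n) : Prop := forall p, 0 <= proj1_sig f p.
End L0nabla.

(* L_0(Omega): measurable real functions, compared almost everywhere.     *)
Section L0Omega.
Context (R : realType) (d : measure_display) (Om : measurableType d)
        (mu : {measure set Om -> \bar R}).

Definition complete_measure : Prop :=
  forall N : set Om, mu.-negligible N -> measurable N.

Definition L0O (k : Om -> R) : Prop := measurable_fun setT k.
Definition aele (a b : Om -> R) : Prop := {ae mu, forall w, a w <= b w}.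
Definition aeeq (a b : Om -> R) : Prop := {ae mu, forall w, a w = b w}.

Definition L0O_lub (S : set (Om -> R)) (k : Om -> R) : Prop :=
  [/\ L0O k, (forall s, S s -> aele s k) &
      (forall u, L0O u -> (forall s, S s -> aele s u) -> aele k u)].
Definition L0O_glb (S : set (Om -> R)) (k : Om -> R) : Prop :=
  [/\ L0O k, (forall s, S s -> aele k s) &
      (forall u, L0O u -> (forall s, S s -> aele u s) -> aele u k)].

Context {disp : Order.disp_t} (B : ctbDistrLatticeType disp).

Definition L0_measure (m : B -> Om -> R) : Prop :=
  [/\ (forall e, L0O (m e)),
      (forall e, aele (fun=> 0) (m e)),
      (forall e, aeeq (m e) (fun=> 0) <-> e = \bot%O),
      (forall e g, Order.meet e g = \bot%O ->
          aeeq (m (Order.join e g)) (fun w => m e w + m g w)) &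
      (
      (* order continuity: e_alpha decreasing to 0 implies m(e_alpha) decreasing to 0 *)
      (forall D : set B, D !=set0 ->
          (forall x y, D x -> D y -> exists z, [/\ D z, (z <= x)%O & (z <= y)%O]) ->
          BA_glb D \bot%O -> L0O_glb (m @` D) (fun=> 0)) /\
      (forall e (a1 a2 : Om -> R), L0O a1 -> L0O a2 ->
          aele (fun=> 0) a1 -> aele (fun=> 0) a2 ->
          aeeq (fun w => Num.min (a1 w) (a2 w)) (fun=> 0) ->
          aeeq (m e) (fun w => a1 w + a2 w) ->
          exists e1 e2, [/\ e = Order.join e1 e2, aeeq (m e1) a1 & aeeq (m e2) a2]))].

Variable m : B -> Om -> R.

Definition simple_ok (l : seq (R * B)) : Prop :=
  (forall i, (i < size l)%N -> 0 <= (nth (0, \bot%O) l i).1) /\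
  (forall i j, (i < size l)%N -> (j < size l)%N -> i <> j ->
     Order.meet (nth (0, \bot%O) l i).2 (nth (0, \bot%O) l j).2 = \bot%O).
Definition simple_fun (l : seq (R * B)) (p : stone B) : \bar R :=
  (\sum_(x <- l) (x.1 * (if pselect (proj1_sig p x.2) then 1 else 0)))%:E.
Definition simple_int (l : seq (R * B)) : Om -> R :=
  fun w => \sum_(x <- l) x.1 * m x.2 w.

Definition int_rel (g : L0n R B) (k : Om -> R) : Prop :=
  L0O_lub [set simple_int l | l in [set l | simple_ok l /\
              (forall p, (simple_fun l p <= proj1_sig g p)%E)]] k.

Definition inL1 (f : L0n R B) : Prop := exists k, int_rel (L0abs f) k.

Definition norm1_le1 (f : L0n R B) : Prop :=
  forall b, int_rel (L0abs f) b -> aele b (fun=> 1).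

Definition L0_bounded_linear (T : L0n R B -> L0n R B) : Prop :=
  [/\ (forall f, inL1 f -> inL1 (T f)),
      (forall f g, inL1 f -> inL1 g -> T (L0add f g) = L0add (T f) (T g)),
      (forall (r : R) f, inL1 f -> T (L0scale r f) = L0scale r (T f)) &
      (exists c, L0O c /\ forall f, inL1 f -> forall a b,
          int_rel (L0abs (T f)) a -> int_rel (L0abs f) b ->
          aele a (fun w => c w * b w))].

Definition opnorm_rel (T : L0n R B -> L0n R B) (k : Om -> R) : Prop :=
  L0O_lub [set a | exists f, [/\ inL1 f, norm1_le1 f & int_rel (L0abs (T f)) a]] k.

Definition L1_lub (S : set (L0n R B)) (s : L0n R B) : Prop :=
  [/\ inL1 s, (forall g, S g -> L0le g s) &
      (forall u, inL1 u -> (forall g, S g -> L0le g u) -> L0le s u)].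

(* L_infty(nabla, m) = C(X(nabla)) and the norms ||.||_infty *)
Definition inLinf (f : L0n R B) : Prop := forall p, proj1_sig f p \is a fin_num.
Definition norminf (f : L0n R B) : \bar R :=
  ereal_inf [set x%:E | x in [set lam : R | 0 <= lam /\
                 forall p, (`|proj1_sig f p| <= lam%:E)%E]].
Definition opnorminf (T : L0n R B -> L0n R B) : \bar R :=
  ereal_sup [set norminf (T f) | f in [set f | inLinf f /\ (norminf f <= 1)%E]].

Definition modulus_props (T A : L0n R B -> L0n R B) : Prop :=
  [/\ L0_bounded_linear A,
      (exists k, opnorm_rel T k /\ opnorm_rel A k),
      (forall f, inL1 f -> L0le (L0abs (T f)) (A (L0abs f))) &
      (forall f, inL1 f -> L0nonneg f ->
         L1_lub [set L0abs (T g) | g in [set g | inL1 g /\ L0le (L0abs g) f]] (A f))].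
End L0Omega.

(* Main.v *)
Require Import Defs.
From HB Require Import structures.
From mathcomp Require Import all_boot all_order all_algebra.
From mathcomp Require Import all_classical all_reals all_analysis.
From mathcomp Require Import measurable_realfun ring lra.
Import Order.Theory GRing.Theory Num.Theory.
Import numFieldNormedType.Exports.
Set Implicit Arguments. Unset Strict Implicit. Unset Printing Implicit Defensive.
Local Open Scope classical_set_scope.
Local Open Scope ring_scope.

(** The modulus is [|T| f = sup { |T h_1| + ... + |T h_n| : h_i >= 0, h_1 + ... + h_n = f }]
for [f >= 0]. Riesz decomposition makes these sums an upward directed family, additivity of the
integral bounds their norms by [||T|| |f|_1], and the Levi property of [L_1(nabla, m)] yields the
supremum; that the supremum in (c) is the same follows from [|a| + |b| = max |a + b| |a - b|].
The estimate [|T g|_1 <= ||T|| |g|_1] needs the L_0(Omega)-module structure, which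
d-decomposability provides: every measurable [E] is realised by an element of nabla, and on
[{|g|_1 <= r}] the operator acts as on [r] times the unit ball.

Identities and inequalities in [L_0(nabla)] are checked pointwise off a nowhere dense set. The
lattice and module operations exist because a continuous real function on a dense open subset of
the extremally disconnected Stone space extends continuously, by its upper envelope. *)

(** * The Stone space *)

(** [T] is linear over the reals only and its bound [c] is arbitrary, whereas (a) compares suprema
    over unit balls. The sharp estimate [|T g|_1 <= ||T|| |g|_1] therefore comes before the modulus,
    whose construction is then run with [||T||] in the role of [c]: every sum over a decomposition
    inherits that bound, and so does the supremum. The crude bound [c] makes [T] local: where
    [|g|_1] vanishes, so does [|T g|_1]. Decompositions are preferred to (c) as the definition
    because splitting and concatenating them gives additivity directly; the form (c) is what the sup
    norm needs, since bounds on the single [|T h_i|] do not give a sharp bound on their sum. The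
    axioms of [m] enter at separate places: order continuity and strict positivity in the Levi
    property, decomposability in [band_elt]. An inequality in L_0(Omega) with a real parameter holds
    off a null set depending on the parameter, so parameters are restricted to the rationals before
    a pointwise conclusion is drawn. *)

Section Ultrafilters.
Context {disp : Order.disp_t} (B : ctbDistrLatticeType disp).
Implicit Types (x y z e : B) (F : set B) (p q : stone B).

Lemma meet_le_bot_compl x y : (Order.meet x y <= \bot)%O -> (x <= Order.compl y)%O.
Proof.
rewrite lex0 => /eqP xy0.
have -> : x = Order.join (Order.meet x y) (Order.meet x (Order.compl y)).
  by rewrite -meetUr joinxC meetx1.
by rewrite xy0 join0x leIr.
Qed.

Definition proper_filter F : Prop :=
  [/\ ~ F \bot%O, F \top%O, (forall x y, F x -> (x <= y)%O -> F y) &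
      (forall x y, F x -> F y -> F (Order.meet x y))].

Lemma proper_filter_ultra F : proper_filter F -> exists p, F `<=` proj1_sig p.
Proof.
move=> [F0 F1 Fup FI].
pose P := [set G : set B | G = set0 \/ (F `<=` G /\ proper_filter G)].
have chainP C : C `<=` P -> total_on C subset -> P (\bigcup_(X in C) X).
  move=> CP Ctot.
  have [[G CG G0]|C0] := pselect (exists2 G, C G & G !=set0); last first.
    left; rewrite -subset0 => x [X CX Xx]; apply: C0.
    by exists X => //; exists x.
  have filt X : C X -> X !=set0 -> F `<=` X /\ proper_filter X.
    by move=> /CP [->|//] [].
  right; split; first by move=> x /((filt _ CG G0).1) Gx; exists G.
  split.
  - by move=> [X CX X0]; have [_ []] := filt _ CX (ex_intro _ _ X0).
  - by exists G => //; have [_ []] := filt _ CG G0.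
  - move=> x y [X CX Xx] xy; exists X => //.
    by have [_ [_ _ Xup _]] := filt _ CX (ex_intro _ _ Xx); exact: Xup xy.
  - move=> x y [X CX Xx] [Y CY Yy].
    have [XY|YX] := Ctot _ _ CX CY.
      exists Y => //; have [_ [_ _ _]] := filt _ CY (ex_intro _ _ Yy); apply => //.
      exact: XY.
    exists X => //; have [_ [_ _ _]] := filt _ CX (ex_intro _ _ Xx); apply => //.
    exact: YX.
have [A [PA maxA]] := Zorn_bigcup chainP.
have [FA [A0 A1 Aup AI]] : F `<=` A /\ proper_filter A.
  case: PA => // A0; exfalso; apply: (maxA F); last by right; split.
  by rewrite A0; split => // H; exact: (H _ F1).
suff uA : is_ultrafilter A by exists (exist _ A uA).
split => // x; apply: contrapT => /not_orP[nx ncx].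
(* The filter generated by [A] and [x]. It is proper: otherwise some [a] in [A] lies below the
   complement of [x], which would then be in [A]. *)
pose G := [set y | exists2 a, A a & (Order.meet a x <= y)%O].
have AG : A `<=` G by move=> y Ay; exists y => //; exact: leIl.
apply: (maxA G).
  split => // GA; apply: nx; apply: GA; exists \top%O => //; exact: leIr.
right; split; first exact: subset_trans AG.
split.
- by move=> [a Aa /meet_le_bot_compl ax]; apply: ncx; exact: Aup ax.
- by exists \top%O => //; exact: lex1.
- by move=> y z [a Aa ay] yz; exists a => //; exact: le_trans yz.
- move=> y z [a Aa ay] [b Ab bz]; exists (Order.meet a b); first exact: AI.
  rewrite lexI; apply/andP; split.
    by apply: le_trans ay; apply: leI2 => //; exact: leIl.
  by apply: le_trans bz; apply: leI2 => //; exact: leIr.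
Qed.

Lemma Ubase_neq0 x : x != \bot%O -> Ubase x !=set0.
Proof.
move=> x0; have [] := @proper_filter_ultra [set y | (x <= y)%O].
  split => /=; [|exact: lex1| |].
  - by rewrite lex0; exact/negP.
  - by move=> y z; exact: le_trans.
  - by move=> y z xy xz; rewrite lexI xy.
by move=> p xp; exists p; apply: xp => /=.
Qed.

Lemma Ubase0 p : ~ Ubase \bot%O p. Proof. by case: p => F []. Qed.
Lemma Ubase1 p : Ubase \top%O p. Proof. by case: p => F []. Qed.

Lemma UbaseS x y p : (x <= y)%O -> Ubase x p -> Ubase y p.
Proof. by case: p => F [_ _ Fup _ _] xy /= Fx; exact: Fup xy. Qed.

Lemma UbaseI x y p : Ubase (Order.meet x y) p <-> Ubase x p /\ Ubase y p.
Proof.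
split; first by move=> xyp; split; apply: UbaseS xyp; [exact: leIl|exact: leIr].
by case: p => F [_ _ _ FI _] /= [? ?]; exact: FI.
Qed.

Lemma UbaseC x p : Ubase (Order.compl x) p <-> ~ Ubase x p.
Proof.
split; last by case: p => F [_ _ _ _ /(_ x)] /= [].
by move=> cxp xp; apply: (@Ubase0 p); rewrite -(meetxC x); apply/UbaseI.
Qed.

Lemma Ubase_le x y : (Ubase x `<=` Ubase y) -> (x <= y)%O.
Proof.
move=> xy; rewrite -[leRHS]complK; apply: meet_le_bot_compl; rewrite lex0.
apply: contrapT => /negP /Ubase_neq0 [p /UbaseI[xp /UbaseC]]; apply.
exact: xy.
Qed.

Lemma Ubase_bot x : (forall p, ~ Ubase x p) -> x = \bot%O.
Proof.
move=> x0; apply/eqP; apply: contrapT => /negP /Ubase_neq0 [p]; exact: x0.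
Qed.

(** Quasi everywhere. As a [set_system] it is handled by the general filter lemmas, exactly like
    almost everywhere statements. *)
Definition qe : set_system (stone B) := [set A | nowhere_dense (~` A)].

Global Instance qe_filter : Filter qe.
Proof.
split => [e [p ep]|P Q qP qQ e /qP[e1 [/qQ[e2 [e20 e21 e2Q]] e1e e1P]]|P Q PQ qP e /qP].
- by exists e; split; [exists p|by []|rewrite setCT setI0].
- exists e2; split => //; first exact: subset_trans e1e.
  rewrite -subset0 => p [pe2] /=; apply; split; apply: contrapT => np.
    by have : (Ubase e1 `&` ~` P) p; [split => //; exact: e21|rewrite e1P].
  by have : (Ubase e2 `&` ~` Q) p; [split|rewrite e2Q].
- move=> [e' [e'0 e'e e'P]]; exists e'; split => //.
  rewrite -subset0 => p [pe' nQ]; rewrite -e'P; split => // Pp; apply: nQ; exact: PQ.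
Qed.

Lemma qe_meets (A : set (stone B)) e : qe A -> Ubase e !=set0 -> exists2 p, Ubase e p & A p.
Proof.
move=> qA /qA[e' [[p e'p] e'e e'A]]; exists p; first exact: e'e.
by apply: contrapT => nA; have : (Ubase e' `&` ~` A) p; [split|rewrite e'A].
Qed.

Definition stone_open (A : set (stone B)) : Prop :=
  forall p, A p -> exists e, Ubase e p /\ Ubase e `<=` A.

Lemma qe_open_dense (A : set (stone B)) : stone_open A ->
  (forall e, Ubase e !=set0 -> exists2 p, Ubase e p & A p) -> qe A.
Proof.
move=> oA dA e /dA[p ep /oA[e' [e'p e'A]]].
exists (Order.meet e e'); split; first by exists p; apply/UbaseI.
  by move=> q /UbaseI[].
by rewrite -subset0 => q [/UbaseI[_ /e'A]].
Qed.

End Ultrafilters.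
Arguments qe {disp B} _.

Section QuasiEverywhere.
Context {disp : Order.disp_t} (B : ctbDistrLatticeType disp).
Implicit Types P Q : stone B -> Prop.

Lemma qeS P Q : (forall p, P p -> Q p) -> qe P -> qe Q.
Proof. by move=> PQ; apply: (@filterS _ qe _). Qed.

Lemma qeE P : (forall p, P p) -> qe P.
Proof. by move=> HP; apply: (@filterE _ qe _). Qed.

Lemma qe_app P Q : qe P -> qe (fun p => P p -> Q p) -> qe Q.
Proof. by move=> qP qPQ; apply: filterS2 qP qPQ => p Pp; apply. Qed.
End QuasiEverywhere.

(** * Limits in the extended reals *)

Section ErealLimits.
Context (R : realType).
Local Open Scope ereal_scope.

Lemma ereal_lt_between (a b : \bar R) : a < b -> exists r : R, a < r%:E < b.
Proof.
case: a b => [a| |] [b| |] //; rewrite ?ltNyy ?ltyy //.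
- rewrite lte_fin => ab; exists ((a + b) / 2)%R.
  by rewrite !lte_fin; apply/andP; split; lra.
- by move=> _; exists (a + 1)%R; rewrite lte_fin ltrDl ltr01 ltry.
- by move=> _; exists (b - 1)%R; rewrite lte_fin ltrBlDr ltrDl ltr01 ltNyr.
- by move=> _; exists 0%R; rewrite ltNyr ltry.
Qed.

(** Real bounds on both sides treat finite and infinite limits alike, so that continuity of an
    extended real function splits into its two semicontinuities. *)
Lemma cvge_lower_upper {T : Type} {F : set_system T} {FF : Filter F} (f : T -> \bar R) a :
  (forall r : R, r%:E < a -> \forall x \near F, r%:E < f x) ->
  (forall r : R, a < r%:E -> \forall x \near F, f x < r%:E) -> f @ F --> a.
Proof.
case: a => [a| |] lo up.
- apply/fine_cvgP; split.
    have := lo (a - 1)%R; rewrite lte_fin ltrBlDr ltrDl ltr01 => /(_ isT).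
    have := up (a + 1)%R; rewrite lte_fin ltrDl ltr01 => /(_ isT).
    by apply: filterS2 => x; case: (f x).
  apply/cvgrPdist_lt => e e0.
  have := lo (a - e)%R; rewrite lte_fin ltrBlDr ltrDl e0 => /(_ isT).
  have := up (a + e)%R; rewrite lte_fin ltrDl e0 => /(_ isT).
  apply: filterS2 => x /=; case: (f x) => [y| |] //=; rewrite !lte_fin => *.
  by rewrite ltr_norml; apply/andP; split; lra.
- by apply/cvgeyPgt => A; apply: lo; rewrite ltry.
- by apply/cvgeNyPlt => A; apply: up; rewrite ltNyr.
Qed.

Lemma cvge_near_gt {T : Type} {F : set_system T} {FF : Filter F} (f : T -> \bar R) a (b : \bar R) :
  f @ F --> a -> b < a -> \forall x \near F, b < f x.
Proof. by move=> fa ba; exact: (fa [set y | b < y] (open_ereal_gt' ba)). Qed.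

Lemma cvge_near_lt {T : Type} {F : set_system T} {FF : Filter F} (f : T -> \bar R) a (b : \bar R) :
  f @ F --> a -> a < b -> \forall x \near F, f x < b.
Proof. by move=> fa ba; exact: (fa [set y | y < b] (open_ereal_lt' ba)). Qed.
End ErealLimits.

(** * Neighbourhoods, extremal disconnectedness and upper envelopes *)

Section StoneNbhs.
Context {disp : Order.disp_t} (B : ctbDistrLatticeType disp).

(** The type [stone] carries no topological structure; its topology is used through these
    neighbourhood filters alone. *)
Definition stone_nbhs (p : stone B) : set_system (stone B) :=
  [set A | exists e, Ubase e p /\ Ubase e `<=` A].

Global Instance stone_nbhs_filter p : ProperFilter (stone_nbhs p).
Proof.
split; first by move=> [e [ep]] /(_ _ ep).
split.
- by exists \top%O; split => //; exact: Ubase1.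
- move=> P Q [e [ep eP]] [e' [ep' eQ]]; exists (Order.meet e e').
  by split; [exact/UbaseI|move=> q /UbaseI[/eP ? /eQ]].
- by move=> P Q PQ [e [ep eP]]; exists e; split => //; exact: subset_trans PQ.
Qed.

Lemma stone_nbhs_Ubase p e : Ubase e p -> stone_nbhs p (Ubase e).
Proof. by move=> ep; exists e; split. Qed.

Hypothesis HB : complete_BA B.

(* [Ubase e] is the closure of [P]: completeness makes the Stone space extremally disconnected. *)
Lemma open_closure_clopen (P : set (stone B)) : stone_open P ->
  exists e, P `<=` Ubase e /\
    forall p A, Ubase e p -> stone_nbhs p A -> exists2 q, A q & P q.
Proof.
move=> oP; have [e [eub elub]] := HB [set e | Ubase e `<=` P].
exists e; split => [p /oP[e' [e'p /eub e'e]]|p A ep [e' [e'p e'A]]].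
  exact: UbaseS e'p.
apply: contrapT => nq.
(* If [e'] missed [P], its complement would bound every clopen subset of [P], hence also their
   supremum [e]. *)
suff : (e <= Order.compl e')%O by move/UbaseS => /(_ _ ep) /UbaseC.
apply: elub => x xP; apply: Ubase_le => q xq; apply/UbaseC => e'q.
by apply: nq; exists q; [exact: e'A|exact: xP].
Qed.

Context (R : realType).
Local Open Scope ereal_scope.
Implicit Types phi h : stone B -> \bar R.

Definition stone_lsc phi : Prop :=
  forall p (r : R), r%:E < phi p -> \forall q \near stone_nbhs p, r%:E < phi q.

(** The upper semicontinuous regularisation of [phi]. *)
Definition upper_env phi (p : stone B) : \bar R :=
  ereal_inf [set ereal_sup (phi @` Ubase e) | e in [set e | Ubase e p]].

Lemma upper_env_ge phi p : phi p <= upper_env phi p.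
Proof.
apply: le_ereal_inf_tmp => _ [e /= ep <-]; apply: ereal_sup_ubound; by exists p.
Qed.

Lemma upper_env_le phi (h : stone B -> \bar R) p : h @ stone_nbhs p --> h p ->
  (\forall q \near stone_nbhs p, phi q <= h q) -> upper_env phi p <= h p.
Proof.
move=> hp phih; rewrite leNgt; apply/negP => /ereal_lt_between[r /andP[hr]].
apply/negP; rewrite -leNgt.
have [e [ep eP]] : \forall q \near stone_nbhs p, phi q <= r%:E.
  apply: filterS2 phih (cvge_near_lt hp hr) => q pq hq.
  exact: le_trans pq (ltW hq).
apply: le_trans (_ : ereal_sup (phi @` Ubase e) <= _).
  by apply: ereal_inf_lbound; exists e.
by apply: ge_ereal_sup => _ [q /= /eP qr <-].
Qed.

(** Upper semicontinuity is built into the envelope. For the lower one, let [e] be the clopen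
    closure of the open set [{phi > s}]: off [e] the envelope is at most [s], and on [e] every
    neighbourhood meets [{phi > s}], so the envelope is at least [s]. *)
Lemma upper_env_continuous phi : stone_lsc phi ->
  forall p, upper_env phi @ stone_nbhs p --> upper_env phi p.
Proof.
move=> lphi p; apply: cvge_lower_upper => r.
  move=> /ereal_lt_between[s /andP[rs sp]].
  have [e [Pe eP]] : exists e, [set q | s%:E < phi q] `<=` Ubase e /\
    forall p A, Ubase e p -> stone_nbhs p A -> exists2 q, A q & s%:E < phi q.
    by apply: open_closure_clopen => q /= /lphi.
  have ep : Ubase e p.
    apply: contrapT => /UbaseC cep; move: sp; apply/negP; rewrite -leNgt.
    apply: le_trans (_ : ereal_sup (phi @` Ubase (Order.compl e)) <= _).
      by apply: ereal_inf_lbound; exists (Order.compl e).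
    apply: ge_ereal_sup => _ [q /= /UbaseC eq <-].
    by rewrite leNgt; apply/negP => /Pe.
  exists e; split => // q eq; apply: lt_le_trans rs _.
  apply: le_ereal_inf_tmp => _ [e' /= e'q <-].
  have [q' e'q' sq'] := eP q _ eq (stone_nbhs_Ubase e'q).
  by apply: le_trans (ltW sq') _; apply: ereal_sup_ubound; exists q'.
move=> /ereal_inf_lt[_ [e /= ep <-] er].
exists e; split => // q eq; apply: le_lt_trans er.
by apply: ereal_inf_lbound; exists e.
Qed.

End StoneNbhs.

(** * The vector lattice of extended continuous functions *)

Section L0nTheory.
Context (R : realType) {disp : Order.disp_t} (B : ctbDistrLatticeType disp).
Implicit Types (f g h : L0n R B) (p q : stone B).

(** [fine] sends infinite values to 0. This does no harm, as those values occur on a nowhere dense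
    set and identities are claimed only off such sets. *)
Definition L0val f p : R := fine (proj1_sig f p).
Local Notation v := L0val.

Definition L0fin f : set (stone B) := [set p | proj1_sig f p \is a fin_num].

Lemma L0_cvg f p : proj1_sig f @ stone_nbhs p --> proj1_sig f p.
Proof. by case: f => f [cf ?] N /= /cf[e [ep eN]]; exists e; split. Qed.

Lemma L0finE f p : L0fin f p -> proj1_sig f p = (v f p)%:E.
Proof. by rewrite /L0fin /v /= => /fineK. Qed.

Lemma L0fin_open f p : L0fin f p -> stone_nbhs p (L0fin f).
Proof. by move=> fp; have := @L0_cvg f p; rewrite (L0finE fp) => /fine_cvgP[]. Qed.

Lemma L0fin_qe f : qe (L0fin f).
Proof.
case: f => f [cf nf]; rewrite /qe /=; rewrite (_ : ~` _ = [set p | f p = +oo \/ f p = -oo]%E) //.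
apply/seteqP; split => p; rewrite /L0fin /=; case: (f p) => [r| |] //=; try by auto.
by case.
Qed.

Lemma L0val_cvg f p : L0fin f p -> v f @ stone_nbhs p --> v f p.
Proof.
move=> fp; have := @L0_cvg f p; rewrite (L0finE fp) => /fine_cvg.
exact.
Qed.

(** A strict violation at [p] persists, by continuity, on a clopen neighbourhood inside [e], and
    such a set meets every set with nowhere dense complement. *)
Lemma L0le_local e f g : qe (fun p => Ubase e p -> v f p <= v g p) ->
  forall p, Ubase e p -> (proj1_sig f p <= proj1_sig g p)%E.
Proof.
move=> fg p ep; rewrite leNgt; apply/negP => /ereal_lt_between[r /andP[gr rf]].
have [e' [e'p e'P]] : stone_nbhs p [set q | proj1_sig g q < r%:E /\ r%:E < proj1_sig f q]%E.
  exact: filterI (cvge_near_lt (@L0_cvg g p) gr) (cvge_near_gt (@L0_cvg f p) rf).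
have ep0 : Ubase (Order.meet e e') !=set0 by exists p; apply/UbaseI.
have [q /UbaseI[eq e'q] [fgq [fq gq]]] :=
  qe_meets (filterI fg (filterI (L0fin_qe f) (L0fin_qe g))) ep0.
have /= [] := e'P _ e'q; rewrite (L0finE fq) (L0finE gq) !lte_fin => a b.
by have := lt_trans a b; rewrite ltNge fgq.
Qed.

Lemma L0leP f g : L0le f g <-> qe (fun p => v f p <= v g p).
Proof.
split => [fg|fg p].
  apply: filterS2 (L0fin_qe f) (L0fin_qe g) => p fp gp.
  by have := fg p; rewrite (L0finE fp) (L0finE gp) lee_fin.
by apply: (@L0le_local \top%O); [apply: qeS fg|exact: Ubase1].
Qed.

Lemma L0ext f g : proj1_sig f =1 proj1_sig g -> f = g.
Proof.
case: f g => [f Hf] [g Hg] /= /funext fg; subst g; congr exist; exact: Prop_irrelevance.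
Qed.

Lemma L0le_anti f g : L0le f g -> L0le g f -> f = g.
Proof. by move=> fg gf; apply: L0ext => p; apply/eqP; rewrite eq_le fg gf. Qed.

Lemma L0eqP f g : f = g <-> qe (fun p => v f p = v g p).
Proof.
split => [->|fg]; first exact: qeE.
by apply: L0le_anti; apply/L0leP; move: fg; apply: qeS => p ->.
Qed.

Lemma isL0_cst (c : R) : isL0 (fun _ : stone B => c%:E : \bar R).
Proof.
split; first by move=> p N /nbhs_singleton N0; exists \top%O; split => //; exact: Ubase1.
by move=> e e0; exists e; split => //; rewrite -subset0 => p [_ []].
Qed.
Definition L0cst (c : R) : L0n R B := exist _ _ (isL0_cst c).

Lemma L0val_cst c p : v (L0cst c) p = c. Proof. by []. Qed.

Lemma L0nonnegP f : L0nonneg f <-> qe (fun p => 0 <= v f p).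
Proof. exact: (L0leP (L0cst 0) f). Qed.

Lemma L0chooseP (P : L0n R B -> Prop) dflt : (exists h, P h) -> P (L0_choose P dflt).
Proof. by rewrite /L0_choose => H; case: pselect => // H'; case: (cid H'). Qed.

Lemma L0absE f p : proj1_sig (L0abs f) p = `|proj1_sig f p|%E.
Proof.
suff : exists h, forall p, proj1_sig h p = `|proj1_sig f p|%E by move/L0chooseP; exact.
have a0 : isL0 (fun p => `|proj1_sig f p|%E).
  split.
    by move=> q N /(cvg_abse (@L0_cvg f q)) [e [eq eN]]; exists e.
  have [_ nf] := proj2_sig f; move=> e /nf[e' [? ? e'0]]; exists e'; split => //.
  rewrite -subset0 -e'0 => q [e'q /=] H; split => //=.
  by case: (proj1_sig f q) H => [r| |] //= []; auto.
by exists (exist _ _ a0).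
Qed.

Lemma L0val_abs f p : v (L0abs f) p = `|v f p|.
Proof. by rewrite /v L0absE; case: (proj1_sig f p) => [r| |] //=; rewrite normr0. Qed.

Lemma L0abs_nonneg f : L0nonneg (L0abs f).
Proof. by move=> p; rewrite L0absE. Qed.

Lemma L0abs_id f : L0nonneg f -> L0abs f = f.
Proof. by move=> f0; apply: L0ext => p; rewrite L0absE gee0_abs. Qed.

Hypothesis HB : complete_BA B.

Lemma L0_extend (phi : stone B -> R) (D : set (stone B)) : qe D ->
  (forall p, D p -> stone_nbhs p D) ->
  (forall p, D p -> phi q @[q --> stone_nbhs p] --> phi p) ->
  exists h, forall p, D p -> proj1_sig h p = (phi p)%:E.
Proof.
move=> qD oD cphi.
(* The value [-oo] off [D] keeps [psi] lower semicontinuous and never contributes to the suprema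
   that form the envelope. *)
pose psi p : \bar R := if pselect (D p) then (phi p)%:E else -oo%E.
have psiE p : D p -> psi p = (phi p)%:E by rewrite /psi; case: pselect.
have lpsi : stone_lsc psi.
  move=> p r; rewrite {1}/psi; case: pselect => // Dp rp.
  have cp : (phi q)%:E @[q --> stone_nbhs p] --> (phi p)%:E.
    by apply: cvg_EFin; [exact: nearW|exact: cphi].
  by apply: filterS2 (oD _ Dp) (cvge_near_gt cp rp) => q /psiE ->.
have envE p : D p -> upper_env psi p = (phi p)%:E.
  move=> Dp; apply/eqP; rewrite eq_le -{2}(psiE _ Dp) upper_env_ge andbT.
  apply: (@upper_env_le _ _ _ psi (EFin \o phi)).
    by apply: cvg_EFin; [exact: nearW|exact: cphi].
  by apply: filterS (oD _ Dp) => q /psiE ->.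
have h0 : isL0 (upper_env psi).
  split; first by move=> p N /(upper_env_continuous HB lpsi)[e [? ?]]; exists e.
  have : qe [set p | upper_env psi p \is a fin_num].
    by apply: qeS qD => p /envE /= ->.
  rewrite /qe /= => H e /H[e' [? ? e'0]]; exists e'; split => //.
  by rewrite -subset0 -e'0 => q [e'q /=] H'; split => //=; case: H' => ->.
by exists (exist _ _ h0) => p /envE.
Qed.

Lemma L0add_fin f g p : L0fin f p -> L0fin g p ->
  proj1_sig (L0add f g) p = (proj1_sig f p + proj1_sig g p)%E.
Proof.
suff : exists h, forall p, proj1_sig f p \is a fin_num -> proj1_sig g p \is a fin_num ->
   proj1_sig h p = (proj1_sig f p + proj1_sig g p)%E by move/L0chooseP; exact.
have [] := @L0_extend (fun p => v f p + v g p) (L0fin f `&` L0fin g).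
- by apply: (@filterI _ qe _); exact: L0fin_qe.
- by move=> q [fq gq]; apply: (@filterI _ (stone_nbhs q) _); exact: L0fin_open.
- by move=> q [fq gq]; apply: cvgD; exact: L0val_cvg.
- move=> h hE; exists h => q fq gq; rewrite hE ?EFinD ?L0finE //.
Qed.

Lemma L0val_add f g : qe (fun p => v (L0add f g) p = v f p + v g p).
Proof.
apply: filterS2 (L0fin_qe f) (L0fin_qe g) => p fp gp.
by rewrite {1}/v L0add_fin // !L0finE.
Qed.

Lemma L0scale_fin r f p : L0fin f p ->
  proj1_sig (L0scale r f) p = (r%:E * proj1_sig f p)%E.
Proof.
suff : exists h, forall p, proj1_sig f p \is a fin_num ->
   proj1_sig h p = (r%:E * proj1_sig f p)%E by move/L0chooseP; exact.
have [] := @L0_extend (fun p => r * v f p) (L0fin f).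
- exact: L0fin_qe.
- by move=> q fq; exact: L0fin_open.
- by move=> q fq; apply: cvgM; [exact: cvg_cst|exact: L0val_cvg].
- move=> h hE; exists h => q fq; rewrite hE ?EFinM ?L0finE //.
Qed.

Lemma L0val_scale r f : qe (fun p => v (L0scale r f) p = r * v f p).
Proof.
by apply: qeS (L0fin_qe f) => p fp; rewrite {1}/v L0scale_fin // !L0finE.
Qed.

Definition ind (e : B) p : R := if pselect (Ubase e p) then 1 else 0.

Lemma ind1 e p : Ubase e p -> ind e p = 1.
Proof. by rewrite /ind; case: pselect. Qed.

Lemma ind0 e p : ~ Ubase e p -> ind e p = 0.
Proof. by rewrite /ind; case: pselect. Qed.

Lemma ind_cvg e p : ind e @ stone_nbhs p --> ind e p.
Proof.
apply: cvg_near_cst; have [ep|ep] := pselect (Ubase e p).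
  by exists e; split => // q eq; rewrite !ind1.
by exists (Order.compl e); split; [exact/UbaseC|move=> q /UbaseC eq; rewrite !ind0].
Qed.

(** The band projection to [e]; it serves as multiplication by an indicator function of
    L_0(Omega). *)
Lemma L0restrict_ex e f : exists h, qe (fun p => v h p = ind e p * v f p).
Proof.
have [] := @L0_extend (fun p => ind e p * v f p) (L0fin f).
- exact: L0fin_qe.
- by move=> q fq; exact: L0fin_open.
- by move=> q fq; apply: cvgM; [exact: ind_cvg|exact: L0val_cvg].
- by move=> h hE; exists h; apply: qeS (L0fin_qe f) => q fq; rewrite /v hE.
Qed.

End L0nTheory.
Local Notation v := L0val.

(** * Reduction of lattice identities to real arithmetic *)

Section QuasiTactic.
Context (R : realType) {disp : Order.disp_t} (B : ctbDistrLatticeType disp).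

(** A disjunction of linear conditions, so that [lra] can treat absolute values by cases. *)
Lemma L0val_abs_cases (f : L0n R B) :
  qe (fun p => (0 <= v f p /\ v (L0abs f) p = v f p) \/ (v f p <= 0 /\ v (L0abs f) p = - v f p)).
Proof.
apply: qeE => p; rewrite L0val_abs.
have [f0|f0] := leP 0 (v f p); first by left; rewrite ger0_norm.
by right; rewrite ltr0_norm // ltW.
Qed.

Lemma L0val_cst_qe c : qe (fun p => v (@L0cst R _ B c) p = c).
Proof. exact: qeE. Qed.

End QuasiTactic.

Ltac qe_with H := apply: (qe_app H); cbv beta.
(** Each compound value becomes a fresh function constrained by its pointwise rule. Generalizing
    removes the term from the goal, so the loop descends to the arguments and ends. *)
Ltac qe_expand := cbv beta; repeat match goal with
 | HB : complete_BA _ |- context [L0val (L0add ?f ?g)] =>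
     qe_with (L0val_add HB f g); generalize (L0val (L0add f g)); intro
 | HB : complete_BA _ |- context [L0val (L0scale ?r ?f)] =>
     qe_with (L0val_scale HB r f); generalize (L0val (L0scale r f)); intro
 | |- context [L0val (L0abs ?f)] =>
     qe_with (L0val_abs_cases f); generalize (L0val (L0abs f)); intro
 | |- context [L0val (@L0cst ?R ?d ?B ?c)] =>
     qe_with (@L0val_cst_qe R d B c); generalize (L0val (@L0cst R d B c)); intro
 end.
Ltac split_hyps := repeat match goal with
 | H : _ \/ _ |- _ => destruct H
 | H : _ /\ _ |- _ => destruct H
 end.
(* Proves an identity or inequality of L_0(nabla) pointwise, off a nowhere dense set. *)
Ltac qe_lra := qe_expand; apply: qeE; intros; split_hyps; lra.

(** * Lattice identities and Riesz decomposition *)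

Section L0nLattice.
Context (R : realType) {disp : Order.disp_t} (B : ctbDistrLatticeType disp).
Hypothesis HB : complete_BA B.
Implicit Types (f g h u : L0n R B).
Local Notation "f +' g" := (L0add f g) (at level 50, left associativity).
Local Notation "0'" := (@L0cst R _ B 0).

Definition L0sub f g := f +' L0scale (-1) g.
(** Positive part, negative part and minimum are linear expressions in [L0abs], which keeps them
    within reach of [qe_lra]. *)
Definition L0pos f := L0scale (1/2) (f +' L0abs f).
Definition L0neg f := L0scale (1/2) (L0sub (L0abs f) f).
Definition L0min f g := L0scale (1/2) (L0sub (f +' g) (L0abs (L0sub f g))).
Definition L0sum (l : seq (L0n R B)) := foldr (@L0add R _ B) 0' l.

Lemma L0le_trans g f h : L0le f g -> L0le g h -> L0le f h.
Proof. by move=> fg gh p; exact: le_trans (gh p). Qed.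

Lemma L0le_refl f : L0le f f. Proof. by move=> p. Qed.

Lemma L0addC f g : f +' g = g +' f.
Proof. by apply/L0eqP; qe_lra. Qed.

Lemma L0addA f g h : f +' (g +' h) = f +' g +' h.
Proof. by apply/L0eqP; qe_lra. Qed.

Lemma L0add0 f : 0' +' f = f.
Proof. by apply/L0eqP; qe_lra. Qed.

Lemma L0pos_neg f : f = L0sub (L0pos f) (L0neg f).
Proof. by apply/L0eqP; rewrite /L0pos /L0neg /L0sub; qe_lra. Qed.

Lemma L0abs_pos_neg f : L0abs f = L0pos f +' L0neg f.
Proof. by apply/L0eqP; rewrite /L0pos /L0neg /L0sub; qe_lra. Qed.

Lemma L0pos_nonneg f : L0nonneg (L0pos f).
Proof. by apply/L0nonnegP; rewrite /L0pos; qe_lra. Qed.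

Lemma L0neg_nonneg f : L0nonneg (L0neg f).
Proof. by apply/L0nonnegP; rewrite /L0neg /L0sub; qe_lra. Qed.

Lemma L0add_nonneg f g : L0nonneg f -> L0nonneg g -> L0nonneg (f +' g).
Proof.
by move=> /L0nonnegP f0 /L0nonnegP g0; apply/L0nonnegP; qe_with f0; qe_with g0; qe_lra.
Qed.

Lemma L0scale_nonneg (r : R) f : 0 <= r -> L0nonneg f -> L0nonneg (L0scale r f).
Proof.
move=> r0 /L0nonnegP f0; apply/L0nonnegP; qe_with f0.
qe_expand; apply: qeE => p -> ?; exact: mulr_ge0.
Qed.

Lemma L0le_add f g f' g' : L0le f f' -> L0le g g' -> L0le (f +' g) (f' +' g').
Proof. by move=> /L0leP H1 /L0leP H2; apply/L0leP; qe_with H1; qe_with H2; qe_lra. Qed.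

Lemma L0sub_nonneg f g : L0le g f -> L0nonneg (L0sub f g).
Proof. by move=> /L0leP H1; apply/L0nonnegP; qe_with H1; rewrite /L0sub; qe_lra. Qed.

Lemma L0subK f g : g +' L0sub f g = f.
Proof. by apply/L0eqP; rewrite /L0sub; qe_lra. Qed.

Lemma L0abs_add f g : L0le (L0abs (f +' g)) (L0abs f +' L0abs g).
Proof. by apply/L0leP; qe_lra. Qed.

Lemma L0min_lel f g : L0le (L0min f g) f.
Proof. by apply/L0leP; rewrite /L0min /L0sub; qe_lra. Qed.

Lemma L0min_ler f g : L0le (L0min f g) g.
Proof. by apply/L0leP; rewrite /L0min /L0sub; qe_lra. Qed.

Lemma L0min_nonneg f g : L0nonneg f -> L0nonneg g -> L0nonneg (L0min f g).
Proof.
move=> /L0nonnegP f0 /L0nonnegP g0; apply/L0nonnegP; qe_with f0; qe_with g0.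
by rewrite /L0min /L0sub; qe_lra.
Qed.

Lemma L0sum_cat l1 l2 : L0sum (l1 ++ l2) = L0sum l1 +' L0sum l2.
Proof.
elim: l1 => [|f l IH] /=; first by rewrite L0add0.
by rewrite IH L0addA.
Qed.

Fixpoint all_nonneg (l : seq (L0n R B)) : Prop :=
  if l is f :: l' then L0nonneg f /\ all_nonneg l' else True.

Lemma all_nonneg_cat l1 l2 : all_nonneg l1 -> all_nonneg l2 -> all_nonneg (l1 ++ l2).
Proof. by elim: l1 => [|f l IH] //= [f0 l0] l20; split => //; exact: IH. Qed.

Lemma L0sum_nonneg l : all_nonneg l -> L0nonneg (L0sum l).
Proof. by elim: l => [_ p|f l IH /= [f0 /IH]]; [exact: lexx|exact: L0add_nonneg]. Qed.

(* The two projections of [s] are a list [a <= l] with sum [h] and the list [l - a]. *)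
Lemma riesz_split l h : all_nonneg l -> L0nonneg h -> L0le h (L0sum l) ->
  exists s : seq (L0n R B * L0n R B),
    [/\ all_nonneg (map fst s), all_nonneg (map snd s), h = L0sum (map fst s) &
        l = map (fun x => x.1 +' x.2) s].
Proof.
elim: l h => [|f l IH] h /=.
  move=> _ h0 hle; exists [::]; split => //; apply: L0le_anti => //.
(* Greedy choice: what remains, [h - min h f], is the positive part of [h - f] and hence lies below
   the sum of the tail. *)
move=> [f0 l0] h0 hle; set a := L0min h f.
have a0 : L0nonneg a by exact: L0min_nonneg.
have [||s [s1 s2 hs ls]] := IH (L0sub h a) l0.
- exact/L0sub_nonneg/L0min_lel.
- move/L0leP: hle => H; move/L0nonnegP: (L0sum_nonneg l0) => H0; apply/L0leP.
  by rewrite /a /L0min /L0sub; qe_with H; qe_with H0; qe_lra.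
exists ((a, L0sub f a) :: s); split => //=.
- by split => //; exact/L0sub_nonneg/L0min_ler.
- by rewrite -hs L0subK.
- by rewrite L0subK -ls.
Qed.

Lemma L0sum_pairs (s : seq (L0n R B * L0n R B)) :
  L0sum (map (fun x => x.1 +' x.2) s) = L0sum (map fst s) +' L0sum (map snd s).
Proof.
elim: s => [|x s IH] /=; first by rewrite L0add0.
by rewrite IH; apply/L0eqP; qe_lra.
Qed.

End L0nLattice.

(** * Dedekind completeness of L_0(Omega) *)

Section AlmostEverywhere.
Context (R : realType) (d : measure_display) (Om : measurableType d)
        (mu : {measure set Om -> \bar R}).
Implicit Types (a b c k : Om -> R).

Lemma ae_app (P Q : Om -> Prop) : {ae mu, forall w, P w} ->
  {ae mu, forall w, P w -> Q w} -> {ae mu, forall w, Q w}.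
Proof. by move=> HP; apply: filterS2 HP => w Pw; apply. Qed.

Lemma ae_rat (P : rat -> Om -> Prop) : (forall q, {ae mu, forall w, P q w}) ->
  {ae mu, forall w, forall q, P q w}.
Proof.
move=> HP.
have : {ae mu, forall w, forall n : nat, if unpickle n is Some q then P q w else True}.
  apply: ae_foralln => n; case: (unpickle n) => [q|]; [exact: HP|exact: aeW].
by apply: filterS => w Pw q; have := Pw (pickle q); rewrite pickleK.
Qed.

Lemma L0O_lub_uniq (S : set (Om -> R)) k k' : L0O_lub mu S k -> L0O_lub mu S k' -> aeeq mu k k'.
Proof.
move=> [mk ub lub] [mk' ub' lub'].
apply: ae_app (lub _ mk' ub') _; apply: ae_app (lub' _ mk ub) _.
by apply: aeW => w ? ?; apply/eqP; rewrite eq_le; apply/andP.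
Qed.

Lemma L0O_lub_eqset (S S' : set (Om -> R)) k :
  (forall u, L0O u -> (forall s, S s -> aele mu s u) <-> (forall s, S' s -> aele mu s u)) ->
  L0O_lub mu S k -> L0O_lub mu S' k.
Proof.
move=> SS [mk ub lub]; split => //; first exact/SS.
by move=> u mu_ /SS H; apply: lub => //; exact: H.
Qed.

(** Rational [eps] suffice, and their exceptional sets unite to a null set. The sign of [c] is free:
    where [c w <= 0], the choice [eps = 1] already gives the claim. *)
Lemma aele_eps a b c : (forall eps : R, 0 < eps -> aele mu a (fun w => b w + eps * c w)) ->
  aele mu a b.
Proof.
move=> H.
have /ae_app : {ae mu, forall w, forall q : rat, 0 < ratr q :> R -> a w <= b w + ratr q * c w}.
  apply: ae_rat => q; have [q0|q0] := boolP (0 < ratr q :> R); last exact: aeW.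
  by apply: ae_app (H _ q0) _; apply: aeW.
apply; apply: aeW => w Hw; have [c0|c0] := leP (c w) 0.
  have := Hw 1%Q; rewrite rmorph1 mul1r => /(_ ltr01); lra.
rewrite leNgt; apply/negP => ba.
have : (0 : R) < (a w - b w) / c w by rewrite divr_gt0 // subr_gt0.
move=> /rat_in_itvoo[q /itvP qi].
have := Hw q; rewrite qi => /(_ isT); apply/negP; rewrite -ltNge -ltrBrDl.
by rewrite -ltr_pdivlMr // qi.
Qed.
End AlmostEverywhere.

Ltac ae_with H := apply: (ae_app H); cbv beta.

Section L0OmegaComplete.
Context (R : realType) (d : measure_display) (Om : measurableType d)
        (mu : {finite_measure set Om -> \bar R}).
Implicit Types (a b c k : Om -> R).

Lemma superlevel_measurable a (q : R) : L0O a -> measurable [set w | q < a w].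
Proof.
move=> ma; have := ma measurableT _ (measurable_itv `]q, +oo[).
rewrite setTI (_ : _ @^-1` _ = [set w | q < a w]) //.
by apply/seteqP; split => w /=; rewrite in_itv /= andbT.
Qed.

Definition listcup (q : R) (l : seq (Om -> R)) : set Om :=
  \big[setU/set0]_(a <- l) [set w | q < a w].

(** Choose finite lists whose superlevel sets have unions of nearly maximal measure. Adding [s] to
    the [n]-th list gains at most [1/(n+1)], so the part of [{q < s}] outside all the unions is
    null. Finiteness of [mu] makes the supremum real and the subtraction legitimate. *)
Lemma exhaust (S : set (Om -> R)) (q : R) : (forall s, S s -> L0O s) ->
  exists u : nat -> seq (Om -> R), (forall n, forall s, List.In s (u n) -> S s) /\
    forall s, S s -> {ae mu, forall w, q < s w -> exists n, listcup q (u n) w}.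
Proof.
move=> mS.
pose ok (l : seq (Om -> R)) := forall s, List.In s l -> S s.
have mcup l : ok l -> measurable (listcup q l).
  elim: l => [|s l IH] okl; rewrite /listcup ?big_nil ?big_cons //.
  apply: measurableU; first by apply: superlevel_measurable; apply/mS/okl; left.
  by apply: IH => t tl; apply: okl; right.
have fmu A : measurable A -> mu A \is a fin_num by move=> mA; exact: fin_num_measure.
pose V := [set fine (mu (listcup q l)) | l in ok].
have V0 : has_sup V.
  split; first by exists (fine (mu (listcup q [::]))); exists [::].
  exists (fine (mu setT)) => _ [l okl <-]; apply: fine_le.
  - exact/fmu/mcup.
  - exact: fmu.
  - by apply: le_measure; rewrite ?inE //; exact: mcup.
have approx n : exists l, ok l /\ sup V - n.+1%:R^-1 < fine (mu (listcup q l)).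
  have [||_ [l okl <-] h] := @sup_adherent _ V (n.+1%:R^-1) => //.
  by exists l.
have /choice[u uP] := approx.
exists u; split => [n|s Ss]; first by have [] := uP n.
pose N := [set w | q < s w] `\` \bigcup_n listcup q (u n).
have ms : measurable [set w | q < s w] by exact/superlevel_measurable/mS.
have mu_ n : measurable (listcup q (u n)) by apply/mcup; have [] := uP n.
have mN : measurable N by apply: measurableD => //; exact: bigcup_measurable.
have N0 : mu N = 0%E.
  apply/eqP; rewrite eq_le measure_ge0 andbT; apply/lee_addgt0Pr => e e0; rewrite add0e.
  have [n _ ne] := near_infty_natSinv_lt (PosNum e0) : \forall n \near \oo, _.
  have {}ne := ne n (leqnn n).
  have [okn hn] := uP n.
  apply: (@le_trans _ _ (mu ([set w | q < s w] `\` listcup q (u n)))).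
    apply: le_measure; rewrite ?inE //; first exact: measurableD.
    by move=> w [qs nw]; split => // ul; apply: nw; exists n.
  rewrite -(@fineK _ (mu _)); last by apply: fmu; exact: measurableD.
  rewrite lee_fin; apply: le_trans (ltW ne).
  have okc : ok (s :: u n) by move=> t [<-//|/okn].
  have : fine (mu (listcup q (s :: u n))) <= sup V.
    by apply: ub_le_sup; [case: V0|exists (s :: u n)].
  have -> : listcup q (s :: u n) = ([set w | q < s w] `\` listcup q (u n)) `|` listcup q (u n).
    rewrite /listcup big_cons; apply/seteqP; split => w; last by case=> [[]|]; [left|right].
    by case=> h; have [] := pselect (listcup q (u n) w); [right|left|right|].
  rewrite measureU //; first rewrite fineD.
  - move=> h; move: hn; rewrite ltrBlDr => /(le_lt_trans h).
    by rewrite addrC ltrD2l => /ltW.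
  - by apply: fmu; exact: measurableD.
  - exact: fmu.
  - exact: measurableD.
  - by apply/seteqP; split => w // [[]].
exists N; split => // w /= /not_implyP[qs nw]; split => // -[n _ un].
by apply: nw; exists n.
Qed.

(* The supremum of a bounded family is the pointwise supremum of a countable subfamily. *)
Lemma L0O_dedekind_complete (S : set (Om -> R)) k : S !=set0 -> (forall s, S s -> L0O s) ->
  L0O k -> (forall s, S s -> aele mu s k) -> exists t, L0O_lub mu S t.
Proof.
move=> [s0 Ss0] mS mk Sk.
have /choice[u uP] := fun q : rat => exhaust (ratr q) mS.
(* One sequence running through all entries of all lists [u q n]; the default [s0] belongs to [S],
   so padding adds nothing foreign. *)
pose F (n : nat) : Om -> R :=
  if unpickle n is Some x then nth s0 (u x.1.1 x.1.2) x.2 else s0.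
have nthS q n i : S (nth s0 (u q n) i).
  have [ltis|] := ltnP i (size (u q n)); last by move=> ?; rewrite nth_default.
  apply: ((uP q).1 n); elim: (u q n) i ltis => [|a l IH] [|i] //=; [by left|].
  by move=> /IH; right.
have FS n : S (F n) by rewrite /F; case: (unpickle n).
(* Truncation by [k] makes the pointwise supremum real everywhere and changes the sequence on a null
   set only. *)
pose F' n w := Num.min (F n w) (k w).
have F'ub w : has_ubound (range (F'^~ w)).
  by exists (k w) => _ [n _ <-]; rewrite /F' ge_min lexx orbT.
pose t w := sup (range (F'^~ w)).
have mt : L0O t.
  have mF' n : measurable_fun setT (F' n).
    by apply: measurable_minr => //; exact/mS.
  have := @measurable_fun_sups _ Om R setT F' 0%N.
  rewrite (_ : (fun x => _) = t); first by apply => // w _; exact: F'ub.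
  apply/funext => w; rewrite /sups /t /= /sdrop; congr sup.
  by apply/seteqP; split => _ [n _ <-]; exists n.
have Fk : {ae mu, forall w, forall n, F n w <= k w}.
  by apply: ae_foralln => n; exact/Sk/FS.
have tge w n : F n w <= k w -> F n w <= t w.
  move=> h; have -> : F n w = F' n w by rewrite /F' min_l.
  by apply: ub_le_sup => //; exists n.
exists t; split => //.
- move=> s Ss.
  have : {ae mu, forall w, forall q : rat, ratr q < s w -> exists n, listcup (ratr q) (u q n) w}.
    by apply: ae_rat => q; exact: (uP q).2.
  move=> /ae_app; apply; ae_with Fk; apply: aeW => w hF hs.
  rewrite leNgt; apply/negP => /rat_in_itvoo[q /itvP qi].
  have [|n] := hs q; first by rewrite qi.
  rewrite /listcup => ul.
  have [i qF] : exists i, ratr q < nth s0 (u q n) i w.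
    elim: (u q n) ul => [|a l IH]; rewrite ?big_nil ?big_cons //.
    by case=> [qa|/IH[i qi']]; [exists 0%N|exists i.+1].
  have FE : F (pickle (q, n, i)) = nth s0 (u q n) i by rewrite /F pickleK.
  have := tge w (pickle (q, n, i)) (hF _); rewrite FE => h.
  have := lt_le_trans qF h; apply/negP; rewrite -leNgt ltW //; by rewrite qi.
- move=> b mb Sb.
  have : {ae mu, forall w, forall n, F n w <= b w}.
    by apply: ae_foralln => n; exact/Sb/FS.
  move=> /ae_app; apply; apply: aeW => w hF.
  apply: ge_sup; first by exists (F' 0%N w); exists 0%N.
  by move=> _ [n _ <-]; rewrite /F' ge_min hF.
Qed.
End L0OmegaComplete.

(** * The vector-valued integral *)

Section SimpleFunctions.
Context (R : realType) (d : measure_display) (Om : measurableType d)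
        (mu : {finite_measure set Om -> \bar R}).
Context {disp : Order.disp_t} (B : ctbDistrLatticeType disp) (m : B -> Om -> R).
Hypothesis Hm : L0_measure mu m.
Implicit Types (l : seq (R * B)) (z e : B).

Lemma m_meas e : L0O (m e). Proof. by have [] := Hm. Qed.
Lemma m_ge0 e : aele mu (fun=> 0) (m e). Proof. by have [] := Hm. Qed.
Lemma m_bot : aeeq mu (m \bot%O) (fun=> 0). Proof. by have [_ _ H _ _] := Hm; apply/H. Qed.
Lemma m_eq0 e : aele mu (m e) (fun=> 0) -> e = \bot%O.
Proof.
move=> H; have [_ _ H0 _ _] := Hm; apply/H0; ae_with H; ae_with (m_ge0 e).
by apply: aeW => w ? ?; apply/eqP; rewrite eq_le; apply/andP.
Qed.
Lemma m_split x e : aeeq mu (m x)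
  (fun w => m (Order.meet x e) w + m (Order.meet x (Order.compl e)) w).
Proof.
have [_ _ _ H _] := Hm.
have /H : Order.meet (Order.meet x e) (Order.meet x (Order.compl e)) = \bot%O.
  by rewrite meetACA meetxC meetx0.
by rewrite -meetUr joinxC meetx1.
Qed.

Definition Sfun l (p : stone B) : R := \sum_(x <- l) x.1 * ind R x.2 p.

Lemma simple_funE l p : simple_fun l p = (Sfun l p)%:E. Proof. by []. Qed.

Definition loc_int z l : Om -> R := fun w => \sum_(x <- l) x.1 * m (Order.meet x.2 z) w.

Lemma loc_int_top l : loc_int \top%O l = simple_int m l.
Proof. by apply/funext => w; apply: eq_bigr => x _; rewrite meetx1. Qed.

Lemma simple_int_meas l : L0O (simple_int m l).
Proof.
rewrite /simple_int; elim: l => [|x l IH].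
  rewrite (_ : (fun w => _) = (fun=> 0)); first exact: measurable_cst.
  by apply/funext => w; rewrite big_nil.
rewrite (_ : (fun w => _) = (fun w => x.1 * m x.2 w + \sum_(y <- l) y.1 * m y.2 w)).
  by apply: measurable_funD => //; apply: measurable_funM => //; exact: m_meas.
by apply/funext => w; rewrite big_cons.
Qed.

Lemma loc_int_split z e l : aeeq mu (loc_int z l)
  (fun w => loc_int (Order.meet z e) l w + loc_int (Order.meet z (Order.compl e)) l w).
Proof.
rewrite /loc_int; elim: l => [|x l IH]; first by apply: aeW => w; rewrite !big_nil addr0.
ae_with IH; ae_with (m_split (Order.meet x.2 z) e); apply: aeW => w h1 h2.
by rewrite !big_cons h2 h1 !meetA; ring.
Qed.

(** Cutting [z] along the first element of the list moves its coefficient into the constant [c] on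
    one half. When the list is exhausted the function is the constant [c] on [z]. *)
Lemma loc_int_ge0 c l z : (forall p, Ubase z p -> 0 <= c + Sfun l p) ->
  aele mu (fun=> 0) (fun w => c * m z w + loc_int z l w).
Proof.
elim: l c z => [|[r e] l IH] c z H.
  rewrite /loc_int; have [[p zp]|z0] := pselect (Ubase z !=set0).
    have := H p zp; rewrite /Sfun big_nil addr0 => c0.
    ae_with (m_ge0 z); apply: aeW => w h; rewrite big_nil addr0; exact: mulr_ge0.
  have -> : z = \bot%O by apply: Ubase_bot => p zp; apply: z0; exists p.
  by ae_with m_bot; apply: aeW => w ->; rewrite big_nil mulr0 addr0.
have H1 : aele mu (fun=> 0) (fun w => (c + r) * m (Order.meet z e) w + loc_int (Order.meet z e) l w).
  apply: IH => p /UbaseI[/H + ep]; rewrite /Sfun big_cons /= ind1 // mulr1; lra.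
have H2 : aele mu (fun=> 0) (fun w => c * m (Order.meet z (Order.compl e)) w
    + loc_int (Order.meet z (Order.compl e)) l w).
  apply: IH => p /UbaseI[/H + /UbaseC ep]; rewrite /Sfun big_cons /= ind0 // mulr0; lra.
ae_with H1; ae_with H2; ae_with (m_split z e); ae_with (loc_int_split z e l).
apply: aeW => w; rewrite /loc_int big_cons /= (meetC e z); nra.
Qed.

Definition lscale (r : R) l : seq (R * B) := map (fun y => (r * y.1, y.2)) l.

Lemma Sfun_cat l1 l2 p : Sfun (l1 ++ l2) p = Sfun l1 p + Sfun l2 p.
Proof. exact: big_cat. Qed.

Lemma Sfun_scale r l p : Sfun (lscale r l) p = r * Sfun l p.
Proof. by rewrite /Sfun big_map mulr_sumr; apply: eq_bigr => y _; rewrite mulrA. Qed.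

Lemma Sfun_seq1 r e p : Sfun [:: (r, e)] p = r * ind R e p.
Proof. exact: big_seq1. Qed.

Lemma Sfun_nil p : Sfun [::] p = 0. Proof. exact: big_nil. Qed.

Lemma Sfun_le_sum l p : Sfun l p <= \sum_(x <- l) `|x.1|.
Proof.
apply: ler_sum => x _; apply: le_trans (ler_norm _) _; rewrite normrM ler_piMr //.
by rewrite /ind; case: pselect => ?; rewrite ?normr1 ?normr0 ?ler01 ?lexx.
Qed.

Lemma simple_int_cat l1 l2 w : simple_int m (l1 ++ l2) w = simple_int m l1 w + simple_int m l2 w.
Proof. exact: big_cat. Qed.

Lemma simple_int_scale r l w : simple_int m (lscale r l) w = r * simple_int m l w.
Proof. by rewrite /simple_int big_map mulr_sumr; apply: eq_bigr => y _; rewrite mulrA. Qed.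

Lemma simple_int_seq1 r e w : simple_int m [:: (r, e)] w = r * m e w.
Proof. exact: big_seq1. Qed.

Lemma simple_int_nil w : simple_int m [::] w = 0. Proof. exact: big_nil. Qed.

(** Nonnegativity applied to [l' - l]. Overlapping elements and negative coefficients are allowed,
    so the integral depends on the function and not on the list. *)
Lemma simple_int_le l l' : (forall p, Sfun l p <= Sfun l' p) ->
  aele mu (simple_int m l) (simple_int m l').
Proof.
move=> H; have h : aele mu (fun=> 0) (fun w => 0 * m \top%O w +
    loc_int \top%O (l' ++ lscale (-1) l) w).
  by apply: loc_int_ge0 => p _; rewrite Sfun_cat Sfun_scale mulN1r add0r subr_ge0.
ae_with h; apply: aeW => w.
by rewrite loc_int_top simple_int_cat simple_int_scale mulN1r mul0r add0r subr_ge0.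
Qed.

Fixpoint disjoint_list l : Prop := if l is x :: l' then
  [/\ 0 <= x.1, (forall y, y \in l' -> Order.meet x.2 y.2 = \bot%O) & disjoint_list l'] else True.

Lemma disjoint_list_ok l : disjoint_list l -> simple_ok l.
Proof.
elim: l => [|x l IH] /=; first by split.
move=> [x0 xl /IH[IH1 IH2]]; split => [[|i] //|[|i] [|j] //= il jl ij]; first exact: IH1.
- exact/xl/mem_nth.
- by rewrite meetC; exact/xl/mem_nth.
- by apply: IH2 => // ij'; apply: ij; rewrite ij'.
Qed.

Lemma disjoint_list_cat z e l1 l2 : disjoint_list l1 -> disjoint_list l2 ->
  (forall y, y \in l1 -> (y.2 <= Order.meet z e)%O) ->
  (forall y, y \in l2 -> (y.2 <= Order.meet z (Order.compl e))%O) ->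
  disjoint_list (l1 ++ l2).
Proof.
elim: l1 => [|x l1 IH] //= [x0 xl l1d] l2d H1 H2; split => //; last first.
  by apply: IH => // y yl; apply: H1; rewrite inE yl orbT.
move=> y; rewrite mem_cat => /orP[/xl//|/H2 yz].
have xz : (x.2 <= Order.meet z e)%O by apply: H1; rewrite inE eqxx.
by apply/eqP; rewrite -lex0; apply: le_trans (leI2 xz yz) _; rewrite meetACA meetxC meetx0.
Qed.

Lemma Sfun_out z l p : (forall y, y \in l -> (y.2 <= z)%O) -> ~ Ubase z p -> Sfun l p = 0.
Proof.
move=> H zp; rewrite /Sfun big1_seq // => y /andP[_ /H yz].
by rewrite ind0 ?mulr0 // => yp; apply: zp; exact: UbaseS yp.
Qed.

(** The same cutting as in [loc_int_ge0]. Replacing values by their positive part at the end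
    produces admissible coefficients and can only increase the integral. *)
Lemma disjoint_refinement c l z : exists l', [/\ disjoint_list l',
  (forall y, y \in l' -> (y.2 <= z)%O),
  (forall p, Ubase z p -> Sfun l' p = Num.max 0 (c + Sfun l p)) &
  aele mu (fun w => c * m z w + loc_int z l w) (simple_int m l')].
Proof.
elim: l c z => [|[r e] l IH] c z.
  exists [:: (Num.max 0 c, z)]; split => //=.
  - by split => //; rewrite le_max lexx.
  - by move=> y; rewrite inE => /eqP ->.
  - by move=> p zp; rewrite /Sfun big_seq1 big_nil addr0 ind1 // mulr1.
  - ae_with (m_ge0 z); apply: aeW => w h; rewrite /loc_int /simple_int big_nil big_seq1 addr0 /=.
    by apply: ler_wpM2r => //; rewrite le_max lexx orbT.
have [l1 [d1 z1 S1 I1]] := IH (c + r) (Order.meet z e).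
have [l2 [d2 z2 S2 I2]] := IH c (Order.meet z (Order.compl e)).
exists (l1 ++ l2); split.
- exact: disjoint_list_cat z1 z2.
- by move=> y; rewrite mem_cat => /orP[/z1|/z2]; rewrite lexI => /andP[].
- move=> p zp; rewrite [LHS]/Sfun big_cat /= -/(Sfun l1 p) -/(Sfun l2 p).
  rewrite [in RHS]/Sfun big_cons /= -/(Sfun l p).
  have [ep|ep] := pselect (Ubase e p).
    rewrite S1; last by apply/UbaseI.
    rewrite (Sfun_out z2); last by move=> /UbaseI[_ /UbaseC].
    by rewrite ind1 // mulr1 addr0 addrA.
  rewrite S2; last by apply/UbaseI; split => //; apply/UbaseC.
  rewrite (Sfun_out z1); last by move=> /UbaseI[_ /ep].
  by rewrite ind0 // mulr0 !add0r.
- ae_with I1; ae_with I2; ae_with (m_split z e); ae_with (loc_int_split z e l).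
  apply: aeW => w; rewrite /loc_int /simple_int big_cons big_cat /= (meetC e z); nra.
Qed.

End SimpleFunctions.

(** * Existence, monotonicity and linearity of the integral *)

Section Integral.
Context (R : realType) (d : measure_display) (Om : measurableType d)
        (mu : {finite_measure set Om -> \bar R}).
Context {disp : Order.disp_t} (B : ctbDistrLatticeType disp) (m : B -> Om -> R).
Hypothesis HB : complete_BA B.
Hypothesis Hm : L0_measure mu m.
Implicit Types (l : seq (R * B)) (z e : B) (f g h : L0n R B) (a b k u : Om -> R).
Local Notation I := (simple_int m).
Local Notation int := (int_rel mu m).

Lemma Sfun_cvg l (p : stone B) : Sfun l @ stone_nbhs p --> Sfun l p.
Proof.
elim: l => [|x l IH].
  by rewrite (_ : Sfun [::] = fun=> 0); [exact: cvg_cst|apply/funext => q; rewrite Sfun_nil].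
rewrite (_ : Sfun (x :: l) = fun q => x.1 * ind R x.2 q + Sfun l q).
  by apply: cvgD IH; apply: cvgM; [exact: cvg_cst|exact: ind_cvg].
by apply/funext => q; rewrite /Sfun big_cons.
Qed.

Lemma isL0_simple l : isL0 (fun p : stone B => (Sfun l p)%:E).
Proof.
split; last by move=> e e0; exists e; split => //; rewrite -subset0 => p [_ []].
move=> p N; have H : (Sfun l q)%:E @[q --> stone_nbhs p] --> (Sfun l p)%:E.
  by apply: cvg_EFin; [exact: nearW|exact: Sfun_cvg].
by move=> /H[e [ep eN]]; exists e.
Qed.
Definition L0simple l : L0n R B := exist _ _ (isL0_simple l).

Lemma L0val_simple l p : v (L0simple l) p = Sfun l p. Proof. by []. Qed.

Definition below l g : Prop := L0le (L0simple l) g.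

Lemma belowP l g : below l g <-> qe (fun p => Sfun l p <= v g p).
Proof. exact: L0leP. Qed.

Lemma below_nil g : L0nonneg g -> below [::] g.
Proof. by move=> g0 p; rewrite /= Sfun_nil. Qed.

(** The positive part of a simple function below [g >= 0] is still below [g], so signed overlapping
    lists have the same upper bounds as the admissible ones. Signed lists can be added and
    subtracted by mere concatenation, on which the linearity proofs rest. *)
Lemma int_relP g k : L0nonneg g -> int g k <-> L0O_lub mu [set I l | l in below^~ g] k.
Proof.
move=> g0.
have ubP u : (forall s, [set I l | l in [set l | simple_ok l /\
     forall p, (simple_fun l p <= proj1_sig g p)%E]] s -> aele mu s u) <->
     (forall s, [set I l | l in below^~ g] s -> aele mu s u).
  split=> H _ [l lg <-].
    have [l' [l'd _ l'S l'I]] := disjoint_refinement Hm 0 l \top%O.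
    have h := H (I l') (ex_intro2 _ _ l' (conj (disjoint_list_ok l'd) _) erefl).
    have {}h : aele mu (I l') u.
      apply: h => p; rewrite simple_funE l'S; last exact: Ubase1.
      by rewrite add0r; case: (leP 0 (Sfun l p)) => _; [exact: lg|exact: g0].
    ae_with h; ae_with l'I; apply: aeW => w; rewrite loc_int_top; lra.
  by apply: H; exists l => //; case: lg.
by split; apply: L0O_lub_eqset => u _; [exact: ubP|exact: iff_sym (ubP u)].
Qed.

Lemma int_meas g k : int g k -> L0O k. Proof. by case. Qed.

Lemma int_ub g k l : L0nonneg g -> int g k -> below l g -> aele mu (I l) k.
Proof. by move=> g0 /(int_relP _ g0)[_ H _] lg; apply: H; exists l. Qed.

Lemma int_le_ub g k u : L0nonneg g -> int g k -> L0O u ->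
  (forall l, below l g -> aele mu (I l) u) -> aele mu k u.
Proof. by move=> g0 /(int_relP _ g0)[_ _ H] mu_ hu; apply: H => // _ [l lg <-]; exact: hu. Qed.

Lemma int_exists g u : L0nonneg g -> L0O u ->
  (forall l, below l g -> aele mu (I l) u) -> exists2 k, int g k & aele mu k u.
Proof.
move=> g0 mu_ hu.
have [||||k kl] := @L0O_dedekind_complete _ _ _ mu [set I l | l in below^~ g] u => //.
- by exists (I [::]); exists [::] => //; exact: below_nil.
- by move=> _ [l _ <-]; exact: (simple_int_meas Hm).
- by move=> _ [l lg <-]; exact: hu.
have ik : int g k by apply/int_relP.
by exists k => //; apply: int_le_ub ik mu_ hu.
Qed.

Lemma int_uniq g k k' : int g k -> int g k' -> aeeq mu k k'.
Proof. exact: L0O_lub_uniq. Qed.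

Lemma int_ge0 g k : L0nonneg g -> int g k -> aele mu (fun=> 0) k.
Proof.
move=> g0 ik; have h := int_ub g0 ik (below_nil g0).
by ae_with h; apply: aeW => w; rewrite simple_int_nil.
Qed.

Lemma int_mono f g b : L0nonneg f -> L0le f g -> int g b -> exists2 a, int f a & aele mu a b.
Proof.
move=> f0 fg ib; apply: int_exists (int_meas ib) _ => // l lf.
apply: int_ub ib _; last exact: L0le_trans fg.
by move=> p; exact: le_trans (fg p).
Qed.

Lemma int_le f g a b : L0nonneg f -> L0le f g -> int f a -> int g b -> aele mu a b.
Proof.
move=> f0 fg ia ib; have [a' ia' a'b] := int_mono f0 fg ib.
by ae_with a'b; ae_with (int_uniq ia ia'); apply: aeW => w ->.
Qed.

Lemma int_cst_ex (c : R) g : L0nonneg g -> L0le g (L0cst B c) -> exists k, int g k.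
Proof.
move=> g0 gc; have mc : L0O (fun w => c * m \top%O w).
  by apply: measurable_funM => //; exact: (m_meas Hm).
have [|k ik _] := int_exists g0 mc; last by exists k.
move=> l lg; have /(simple_int_le Hm) h : forall p, Sfun l p <= Sfun [:: (c, \top%O)] p.
  move=> p; rewrite Sfun_seq1 ind1 ?mulr1; last exact: Ubase1.
  by have := le_trans (lg p) (gc p); rewrite /= lee_fin.
by ae_with h; apply: aeW => w; rewrite simple_int_seq1.
Qed.

(** The closure of [{f > r}] is clopen, and continuity keeps it inside [{f >= r}]; it replaces the
    level set, which need not be clopen. *)
Lemma level_elt f (r : R) : exists e, forall p,
  ((r%:E < proj1_sig f p)%E -> Ubase e p) /\ (Ubase e p -> (r%:E <= proj1_sig f p)%E).
Proof.
have [|e [H1 H2]] := open_closure_clopen HB (P := [set p | (r%:E < proj1_sig f p)%E]).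
  by move=> p /= h; exact: cvge_near_gt (@L0_cvg _ _ _ f p) h.
exists e => p; split; first exact: H1.
move=> ep; rewrite leNgt; apply/negP => h.
have [q /= h1 h2] := H2 p _ ep (cvge_near_lt (@L0_cvg _ _ _ f p) h).
by have := lt_trans h1 h2; rewrite ltxx.
Qed.

(** The staircase adding [eps] on the level elements of [eps, 2 eps, ..., N eps]. As [f] may be
    unbounded, it is within [eps] of [f] only where it has not reached its top [N eps]. *)
Lemma simple_approx f (eps : R) (N : nat) : L0nonneg f -> 0 < eps ->
  exists2 l, below l f & qe (fun p => v f p - eps <= Sfun l p \/ N%:R * eps <= Sfun l p).
Proof.
move=> f0 eps0.
suff [l lP] : exists l, forall p, L0fin f p ->
    [/\ Sfun l p <= v f p, Sfun l p <= N%:R * eps &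
        v f p - eps <= Sfun l p \/ N%:R * eps <= Sfun l p].
  exists l; first by apply/belowP; apply: qeS (L0fin_qe f) => p /lP[].
  by apply: qeS (L0fin_qe f) => p /lP[].
elim: N => [|N [l IH]].
  exists [::] => p fp; rewrite Sfun_nil mul0r; split => //; last by right.
  by have := f0 p; rewrite (L0finE fp) lee_fin.
have [e eP] := level_elt f (N.+1%:R * eps).
exists ((eps, e) :: l) => p fp; have [h1 h2 h3] := IH p fp.
have [ep1 ep2] := eP p; rewrite (L0finE fp) lte_fin in ep1; rewrite (L0finE fp) lee_fin in ep2.
have NE : N.+1%:R * eps = N%:R * eps + eps by rewrite -natr1 mulrDl mul1r.
rewrite NE in ep1 ep2 *; rewrite /Sfun big_cons /= -/(Sfun l p).
move: (N%:R * eps) h2 h3 ep1 ep2 => Ne h2 h3 ep1 ep2 {NE eP IH}.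
have [ep|ep] := pselect (Ubase e p).
  have {}ep2 := ep2 ep; rewrite ind1 // mulr1; split; [lra|lra|].
  by case: h3 => h3; [left|right]; lra.
have fle : v f p <= Ne + eps by rewrite leNgt; apply/negP => /ep1.
rewrite ind0 // mulr0 add0r; split => //; [lra|].
by left; case: h3 => h3; lra.
Qed.

Lemma int_add f g a b : L0nonneg f -> L0nonneg g -> int f a -> int g b ->
  int (L0add f g) (fun w => a w + b w).
Proof.
move=> f0 g0 ia ib; have fg0 := L0add_nonneg HB f0 g0.
apply/int_relP => //; split.
- by apply: measurable_funD; [exact: int_meas ia|exact: int_meas ib].
- move=> _ [l /belowP lfg <-]; apply: (@aele_eps _ _ _ _ _ _ (m \top%O)) => eps eps0.
  pose M := \sum_(x <- l) `|x.1|.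
  have SM p : Sfun l p <= M by exact: Sfun_le_sum.
  (* With this [N], the function [l - lf - eps] lies below [g]: where [lf >= f - eps] because
     [l <= f + g], and where [lf] has reached [N eps >= M >= l] because it is negative. *)
  have [N MN] : exists N : nat, M <= N%:R * eps.
    exists (Num.truncn (M / eps)).+1; rewrite -ler_pdivrMr //; exact/ltW/truncnS_gt.
  have [lf lff lfa] := simple_approx N f0 eps0.
  have Hf := int_ub f0 ia lff.
  have Hg : aele mu (I (l ++ lscale (-1) lf ++ [:: (- eps, \top%O)])) b.
    apply: int_ub ib _ => //; apply/belowP; qe_with lfg; qe_with lfa.
    move/L0nonnegP : g0 => g0'; qe_with g0'; qe_with (L0val_add HB f g).
    apply: qeE => p h1 h2 h3 h4; rewrite !Sfun_cat Sfun_scale Sfun_seq1 ind1; last exact: Ubase1.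
    have := SM p; case: h3 => h3; lra.
  ae_with Hf; ae_with Hg; apply: aeW => w.
  by rewrite !simple_int_cat simple_int_scale simple_int_seq1; lra.
- move=> u mu_ Hu.
  (* The supremum over pairs is taken one variable at a time: first over lists below [f] with [l']
     fixed, then over [l']. *)
  have Hl l' : below l' g -> aele mu a (fun w => u w - I l' w).
    move=> l'g; apply: int_le_ub ia _ _ => //.
      by apply: measurable_funB => //; exact: (simple_int_meas Hm).
    move=> l lf; have h : aele mu (I (l ++ l')) u.
      apply: Hu; exists (l ++ l') => //; move/belowP: lf => lf; move/belowP: l'g => l'g.
      apply/belowP; qe_with lf; qe_with l'g; qe_with (L0val_add HB f g).
      by apply: qeE => p; rewrite Sfun_cat; lra.
    by ae_with h; apply: aeW => w; rewrite simple_int_cat; lra.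
  have h : aele mu b (fun w => u w - a w).
    apply: int_le_ub ib _ _ => //; first by apply: measurable_funB => //; exact: int_meas ia.
    by move=> l lg; ae_with (Hl _ lg); apply: aeW => w; lra.
  by ae_with h; apply: aeW => w; lra.
Qed.

Lemma int0 : int (L0cst B 0) (fun=> 0).
Proof.
have c0 : L0nonneg (@L0cst R _ B 0) by move=> p /=.
apply/int_relP => //; split; first exact: measurable_cst.
- move=> _ [l lg <-]; have /(simple_int_le Hm) h : forall p, Sfun l p <= Sfun [::] p.
    by move=> p; rewrite Sfun_nil; have := lg p; rewrite lee_fin.
  by ae_with h; apply: aeW => w; rewrite simple_int_nil.
- move=> u _ /(_ (I [::])) h; have {}h : aele mu (I [::]) u.
    by apply: h; exists [::] => //; exact: below_nil.
  by ae_with h; apply: aeW => w; rewrite simple_int_nil.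
Qed.

Lemma int_scale (r : R) f a : 0 <= r -> L0nonneg f -> int f a ->
  int (L0scale r f) (fun w => r * a w).
Proof.
rewrite le_eqVlt => /predU1P[<- _ _|r0 f0 ia].
  have -> : L0scale 0 f = L0cst B 0 by apply/L0eqP; qe_lra.
  by rewrite (_ : (fun w => _) = (fun=> 0)); [exact: int0|apply/funext => w; rewrite mul0r].
have rf0 := L0scale_nonneg HB (ltW r0) f0.
have below_scale l : below l f -> below (lscale r l) (L0scale r f).
  move=> /belowP lf; apply/belowP; qe_with lf; qe_with (L0val_scale HB r f).
  by apply: qeE => p -> lf'; rewrite Sfun_scale ler_pM2l.
have rV0 : 0 < r^-1 by rewrite invr_gt0.
apply/int_relP => //; split.
- by apply: measurable_funM => //; exact: int_meas ia.
- move=> _ [l /belowP lf <-]; have : below (lscale r^-1 l) f.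
    apply/belowP; qe_with lf; qe_with (L0val_scale HB r f).
    by apply: qeE => p -> lf'; rewrite Sfun_scale mulrC ler_pdivrMr // mulrC.
  move=> /(int_ub f0 ia) h; ae_with h; apply: aeW => w.
  by rewrite simple_int_scale mulrC ler_pdivrMr // mulrC.
- move=> u mu_ Hu; have h : aele mu a (fun w => r^-1 * u w).
    apply: int_le_ub ia _ _ => //; first by apply: measurable_funM.
    move=> l /below_scale lf; have h : aele mu (I (lscale r l)) u by apply: Hu; exists (lscale r l).
    ae_with h; apply: aeW => w; rewrite simple_int_scale.
    by rewrite [_^-1 * _]mulrC ler_pdivlMr // mulrC.
  ae_with h; apply: aeW => w.
  by rewrite [_^-1 * _]mulrC ler_pdivlMr // mulrC.
Qed.
End Integral.

(** * The Levi property *)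

Section Levi.
Context (R : realType) (d : measure_display) (Om : measurableType d)
        (mu : {finite_measure set Om -> \bar R}).
Context {disp : Order.disp_t} (B : ctbDistrLatticeType disp) (m : B -> Om -> R).
Hypothesis HB : complete_BA B.
Hypothesis Hm : L0_measure mu m.
Implicit Types (l : seq (R * B)) (e : B) (f g h : L0n R B).
Local Notation int := (int_rel mu m).

Variables (F : set (L0n R B)) (k : Om -> R).
Hypothesis F0 : F !=set0.
Hypothesis Fnn : forall f, F f -> L0nonneg f.
Hypothesis Fdir : forall f g, F f -> F g -> exists h, [/\ F h, L0le f h & L0le g h].
Hypothesis mk : L0O k.
Hypothesis Fint : forall f, F f -> exists2 a, int f a & aele mu a k.

(** The pointwise supremum is lower semicontinuous only, hence the envelope [s]. That [s] is finite
    on a dense set is not known in advance; it follows from the bound on simple functions below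
    [s]. *)
Let phi (p : stone B) : \bar R := ereal_sup [set proj1_sig f p | f in F].
Let s := upper_env phi.

Let phi_lsc : stone_lsc phi.
Proof.
move=> p r /ereal_sup_gt[_ [f Ff <-] rf].
apply: filterS (cvge_near_gt (@L0_cvg _ _ _ f p) rf) => q rq.
by apply: lt_le_trans rq _; apply: ereal_sup_ubound; exists f.
Qed.

Let s_cvg p : s @ stone_nbhs p --> s p.
Proof. exact: upper_env_continuous. Qed.

Let s_ub f p : F f -> (proj1_sig f p <= s p)%E.
Proof.
by move=> Ff; apply: le_trans (upper_env_ge _ _); apply: ereal_sup_ubound; exists f.
Qed.

Let s_ge0 p : (0 <= s p)%E.
Proof. by have [f Ff] := F0; apply: le_trans (s_ub p Ff); exact: Fnn. Qed.

(* Off a set of small measure every simple function below the envelope is, up to [eps],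
   below a member of the family. *)
Let simple_int_le_levi l : (forall p, ((Sfun l p)%:E <= s p)%E) -> aele mu (simple_int m l) k.
Proof.
move=> ls; apply: (@aele_eps _ _ _ _ _ _ (m \top%O)) => eps eps0.
pose M := 1 + \sum_(x <- l) `|x.1|.
have M0 : 0 < M by rewrite ltr_pwDl // sumr_ge0.
have SM p : Sfun l p <= M by apply: le_trans (Sfun_le_sum l p) _; rewrite lerDr.
pose leps := l ++ [:: (- eps, \top%O)].
have lepsE p : Sfun leps p = Sfun l p - eps.
  by rewrite Sfun_cat Sfun_seq1 ind1 ?mulr1 //; exact: Ubase1.
(* The exceptional elements: off [e], the function [l - eps] is below a member of the family. *)
pose D := [set e | exists2 f, F f &
  forall p, ~ Ubase e p -> ((Sfun leps p)%:E <= proj1_sig f p)%E].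
have level f : F f -> exists2 e, D e &
    forall p, Ubase e p -> (proj1_sig f p <= (Sfun leps p)%:E)%E.
  move=> Ff; have [e eP] := level_elt HB (L0sub (L0simple leps) f) 0.
  have hE : qe (fun p => v (L0sub (L0simple leps) f) p = Sfun leps p - v f p).
    rewrite /L0sub; qe_expand; apply: qeE => p -> ->; rewrite L0val_simple; ring.
  have hfin := L0fin_qe (L0sub (L0simple leps) f).
  exists e.
    exists f => // p /UbaseC nep.
    apply: (@L0le_local _ _ _ _ (L0simple leps) f _ p nep).
    qe_with hE; qe_with hfin; apply: qeE => q fq hq /UbaseC neq; rewrite L0val_simple.
    rewrite -subr_le0 -hq leNgt; apply/negP => h0; apply/neq/(eP q).1.
    by rewrite (L0finE fq) lte_fin.
  move=> p ep; apply: (@L0le_local _ _ _ _ f (L0simple leps) _ p ep).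
  qe_with hE; qe_with hfin; apply: qeE => q fq hq eq; rewrite L0val_simple.
  by rewrite -subr_ge0 -hq -lee_fin -L0finE //; exact: (eP q).2.
have D0 : D !=set0 by have [f /level[e De _]] := F0; exists e.
have Ddir x y : D x -> D y -> exists z, [/\ D z, (z <= x)%O & (z <= y)%O].
  move=> [f Ff fP] [g Fg gP]; have [h [Fh fh gh]] := Fdir Ff Fg.
  exists (Order.meet x y); split; [|exact: leIl|exact: leIr].
  exists h => // p nxy; have [xp|nxp] := pselect (Ubase x p).
    by apply: le_trans (gh p); apply: gP => yp; apply: nxy; apply/UbaseI.
  by apply: le_trans (fh p); exact: fP.
(* On a common lower bound [e0] every member of the family is at most [l - eps], hence so is [s]; as
   [l <= s], this forces [e0] to be empty. *)
have Dglb : BA_glb D \bot%O.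
  split => [x _|e0 e0D]; first exact: le0x.
  rewrite lex0; apply/eqP; apply: Ubase_bot => p e0p.
  have : (s p <= (Sfun leps p)%:E)%E.
    apply: (@upper_env_le _ _ _ phi (fun p => (Sfun leps p)%:E)).
      by apply: cvg_EFin; [exact: nearW|exact: Sfun_cvg].
    apply: filterS (stone_nbhs_Ubase e0p) => q e0q.
    apply: ge_ereal_sup => _ [f Ff <-]; have [e De eP] := level f Ff.
    by apply: eP; apply: UbaseS e0q; exact: e0D.
  move=> /(le_trans (ls p)); rewrite lee_fin lepsE; lra.
have [_ _ _ _ [Hcont _]] := Hm.
have [_ _ glb] := Hcont D D0 Ddir Dglb.
have mI := simple_int_meas Hm l; have mtop := m_meas Hm \top%O.
(* The argument is a lower bound of all [m e] with [e] in [D], and order continuity makes 0 their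
   infimum. *)
have h : aele mu (fun w => M^-1 * (simple_int m l w - eps * m \top%O w - k w)) (fun=> 0).
  apply: glb.
    apply: measurable_funM => //; do 2?apply: measurable_funB => //.
    by apply: measurable_funM.
  move=> _ [e [f Ff fP] <-]; have [a ia ak] := Fint Ff.
  (* Subtracting [M] on [e] makes the function negative there; off [e] it is below [f] by the choice
     of [e]. *)
  have /(int_ub Hm (Fnn Ff) ia) h : below (leps ++ [:: (- M, e)]) f.
    move=> p /=; rewrite Sfun_cat Sfun_seq1; have [ep|ep] := pselect (Ubase e p).
      rewrite ind1 // mulr1; apply: le_trans (Fnn Ff p); rewrite lee_fin lepsE.
      by have := SM p; lra.
    by rewrite ind0 // mulr0 addr0; exact: fP.
  ae_with h; ae_with ak; apply: aeW => w ak'.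
  rewrite !simple_int_cat !simple_int_seq1 => h'.
  by rewrite mulrC ler_pdivrMr // [_ * M]mulrC; lra.
ae_with h; apply: aeW => w; rewrite mulrC ler_pdivrMr // mul0r; lra.
Qed.

Let s_fin_open (p : stone B) : s p \is a fin_num -> stone_nbhs p [set q | s q \is a fin_num].
Proof.
move=> sp; have := @s_cvg p; rewrite -{1}(fineK sp) => /fine_cvgP[].
by [].
Qed.

(** If [s] were infinite on [e], then [1/eps] times the indicator of [e] would lie below [s] for
    every [eps]. Hence [m e <= eps k], so [m e = 0] and [e] is empty. *)
Let s_fin_qe : qe [set p | s p \is a fin_num].
Proof.
apply: qe_open_dense => [p /s_fin_open//|e e0].
apply: contrapT => ns; suff e_bot : e = \bot%O by case: e0 => p; rewrite e_bot => /Ubase0.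
apply: (m_eq0 Hm); apply: (@aele_eps _ _ _ _ _ _ k) => eps eps0.
have h : aele mu (simple_int m [:: (eps^-1, e)]) k.
  apply: simple_int_le_levi => p; rewrite Sfun_seq1; have [ep|ep] := pselect (Ubase e p).
    have : ~ s p \is a fin_num by move=> sp; apply: ns; exists p.
    have := s_ge0 p; case: (s p) => [r _ h|_ _|//]; last by rewrite leey.
    by exfalso; apply: h.
  by rewrite ind0 // mulr0.
ae_with h; apply: aeW => w; rewrite simple_int_seq1 mulrC ler_pdivrMr // add0r.
by rewrite mulrC.
Qed.

Let s_isL0 : isL0 s.
Proof.
split; first by move=> p N /s_cvg[e [? ?]]; exists e.
move=> e /s_fin_qe [e' [? ? e'0]]; exists e'; split => //.
by rewrite -subset0 -e'0 => q [e'q /=] H'; split => //=; case: H' => ->.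
Qed.

Lemma levi : exists t, [/\ L0nonneg t, (forall f, F f -> L0le f t),
  (forall u, (forall f, F f -> L0le f u) -> L0le t u) & exists2 b, int t b & aele mu b k].
Proof.
exists (exist _ _ s_isL0); split => [p|f Ff p|u uF p|]; rewrite /=.
- exact: s_ge0.
- exact: s_ub.
- apply: (@upper_env_le _ _ _ phi (proj1_sig u)); first exact: L0_cvg.
  apply: filterE => q; apply: ge_ereal_sup => _ [f Ff <-]; exact: uF.
- apply: (int_exists Hm) => //= l lt; apply: simple_int_le_levi => p; exact: lt.
Qed.
End Levi.

(** * The modulus of an operator *)

Section L1.
Context (R : realType) (d : measure_display) (Om : measurableType d)
        (mu : {finite_measure set Om -> \bar R}).
Context {disp : Order.disp_t} (B : ctbDistrLatticeType disp) (m : B -> Om -> R).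
Hypothesis HB : complete_BA B.
Hypothesis Hm : L0_measure mu m.
Implicit Types (f g h : L0n R B).
Local Notation int := (int_rel mu m).
Local Notation L1 := (inL1 mu m).

Lemma L1_int f : L0nonneg f -> L1 f -> exists a, int f a.
Proof. by move=> f0 [a]; rewrite L0abs_id // => ia; exists a. Qed.

Lemma int_L1 f a : L0nonneg f -> int f a -> L1 f.
Proof. by move=> f0 ia; exists a; rewrite L0abs_id. Qed.

Lemma L1_abs f : L1 f -> L1 (L0abs f).
Proof. by move=> [a ia]; apply: int_L1 ia; exact: L0abs_nonneg. Qed.

Lemma L1_le f g : L0le (L0abs f) g -> L1 g -> L1 f.
Proof.
move=> fg; have g0 : L0nonneg g by move=> p; exact: le_trans (L0abs_nonneg f p) (fg p).
move=> /(L1_int g0)[b ib].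
by have [a ia _] := int_mono Hm (L0abs_nonneg f) fg ib; exists a.
Qed.

Lemma L1_le_nonneg f g : L0nonneg f -> L0le f g -> L1 g -> L1 f.
Proof. by move=> f0 fg; apply: L1_le; rewrite L0abs_id. Qed.

Lemma L1_add f g : L1 f -> L1 g -> L1 (L0add f g).
Proof.
move=> [a ia] [b ib]; apply: L1_le (L0abs_add HB f g) _.
apply: int_L1 (int_add HB Hm (L0abs_nonneg f) (L0abs_nonneg g) ia ib).
by apply: L0add_nonneg; try exact: L0abs_nonneg.
Qed.

Lemma L0abs_scale (r : R) f : L0abs (L0scale r f) = L0scale `|r| (L0abs f).
Proof.
apply/L0eqP; qe_with (L0val_scale HB r f); qe_with (L0val_scale HB `|r| (L0abs f)).
by apply: qeE => p h1 h2; rewrite L0val_abs h2 h1 L0val_abs normrM.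
Qed.

Lemma L1_scale (r : R) f : L1 f -> L1 (L0scale r f).
Proof.
move=> [a ia]; exists (fun w => `|r| * a w); rewrite L0abs_scale.
by apply: (int_scale HB Hm) => //; exact: L0abs_nonneg.
Qed.

Lemma L1_sub f g : L1 f -> L1 g -> L1 (L0sub f g).
Proof. by move=> *; apply: L1_add => //; exact: L1_scale. Qed.

Lemma L1_pos f : L1 f -> L1 (L0pos f).
Proof. by move=> *; apply: L1_scale; apply: L1_add => //; exact: L1_abs. Qed.

Lemma L1_neg f : L1 f -> L1 (L0neg f).
Proof. by move=> *; apply: L1_scale; apply: L1_sub => //; exact: L1_abs. Qed.

Lemma L1_zero : L1 (L0cst B 0).
Proof. by apply: int_L1 (int0 Hm) => p /=. Qed.
End L1.

Section Modulus.
Context (R : realType) (d : measure_display) (Om : measurableType d)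
        (mu : {finite_measure set Om -> \bar R}).
Context {disp : Order.disp_t} (B : ctbDistrLatticeType disp) (m : B -> Om -> R).
Hypothesis HB : complete_BA B.
Hypothesis Hm : L0_measure mu m.
Implicit Types (f g h u t : L0n R B) (l : seq (L0n R B)).
Local Notation int := (int_rel mu m).
Local Notation L1 := (inL1 mu m).
Local Notation "f +' g" := (L0add f g) (at level 50, left associativity).
Local Notation "0'" := (@L0cst R _ B 0).

Variables (T : L0n R B -> L0n R B) (c : Om -> R).
Hypothesis TL1 : forall f, L1 f -> L1 (T f).
Hypothesis Tadd : forall f g, L1 f -> L1 g -> T (f +' g) = T f +' T g.
Hypothesis Tscale : forall (r : R) f, L1 f -> T (L0scale r f) = L0scale r (T f).
Hypothesis mc : L0O c.
Hypothesis Tbound : forall f, L1 f -> forall a b,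
  int (L0abs (T f)) a -> int (L0abs f) b -> aele mu a (fun w => c w * b w).

Definition varsum l : L0n R B := L0sum (map (fun h => L0abs (T h)) l).
Local Notation W := varsum.

Fixpoint all_L1 l : Prop := if l is f :: l' then L1 f /\ all_L1 l' else True.

Lemma all_L1_sum l : all_nonneg l -> L1 (L0sum l) -> all_L1 l.
Proof.
elim: l => [|f l IH] //= [f0 l0] H.
have s0 := L0sum_nonneg HB l0; split.
  apply: (L1_le_nonneg Hm f0 _ H); apply/L0leP; move/L0nonnegP: s0 => s0; qe_with s0; qe_lra.
apply: IH => //; apply: (L1_le_nonneg Hm s0 _ H); apply/L0leP; move/L0nonnegP: f0 => f0.
by qe_with f0; qe_lra.
Qed.

Lemma T_zero : T 0' = 0'.
Proof.
have E (f : L0n R B) : L0scale 0 f = 0' by apply/L0eqP; qe_lra.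
by have := Tscale 0 (L1_zero Hm); rewrite !E.
Qed.

Lemma T_sub f g : L1 f -> L1 g -> T (L0sub f g) = L0sub (T f) (T g).
Proof. by move=> f1 g1; rewrite Tadd ?Tscale //; exact: (L1_scale HB Hm). Qed.

Lemma varsum_cat l1 l2 : W (l1 ++ l2) = W l1 +' W l2.
Proof. by rewrite /W map_cat L0sum_cat. Qed.

Lemma varsum_nonneg l : L0nonneg (W l).
Proof.
apply: L0sum_nonneg => //; elim: l => //= f l IH; split => //; exact: L0abs_nonneg.
Qed.

Lemma L1_sum l : all_L1 l -> L1 (L0sum l).
Proof. by elim: l => [_|f l IH /= [f1 /IH]]; [exact: L1_zero|exact: L1_add]. Qed.

Lemma abs_T_sum l : all_L1 l -> L0le (L0abs (T (L0sum l))) (W l).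
Proof.
elim: l => [_|f l IH /= [f1 l1]].
  by rewrite /= T_zero /W /= L0abs_id //; exact: L0le_refl.
rewrite Tadd //; last exact: L1_sum.
apply: L0le_trans (L0abs_add HB _ _) _.
exact: (L0le_add HB (L0le_refl _) (IH l1)).
Qed.

Lemma varsum_pairs (s : seq (L0n R B * L0n R B)) : all_L1 (map fst s) -> all_L1 (map snd s) ->
  L0le (W (map (fun x => x.1 +' x.2) s)) (W (map fst s) +' W (map snd s)).
Proof.
elim: s => [_ _|x s IH /= [x1 s1] [x2 s2]]; first by rewrite /= /W /= L0add0 //; exact: L0le_refl.
move: (IH s1 s2); rewrite /W /= Tadd // => /L0leP H; apply/L0leP; qe_with H.
generalize (map (fun h => L0abs (T h)) (map (fun x => x.1 +' x.2) s)).
by intro; qe_lra.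
Qed.

Lemma int_varsum l b : all_nonneg l -> all_L1 l -> int (L0sum l) b ->
  exists2 a, int (W l) a & aele mu a (fun w => c w * b w).
Proof.
elim: l b => [b _ _ ib|f l IH b /= [f0 l0] [f1 l1] ib].
  exists (fun=> 0); first exact: (int0 Hm).
  ae_with (int_uniq ib (int0 Hm)); apply: aeW => w ->; by rewrite mulr0.
have s0 := L0sum_nonneg HB l0.
have [b1 ib1] := L1_int f0 f1; have [b2 ib2] := L1_int s0 (L1_sum l1).
have [a2 ia2 ab2] := IH b2 l0 l1 ib2; have [a1 ia1] := TL1 f1.
have ab1 : aele mu a1 (fun w => c w * b1 w) by apply: (Tbound f1) => //; rewrite L0abs_id.
exists (fun w => a1 w + a2 w).
  by apply: (int_add HB Hm) => //; [exact: L0abs_nonneg|exact: varsum_nonneg].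
ae_with ab1; ae_with ab2; ae_with (int_uniq ib (int_add HB Hm f0 s0 ib1 ib2)).
by apply: aeW => w -> h1 h2; rewrite mulrDr lerD.
Qed.

(** Each entry of [l] splits into a part for [f] and a part for [g]; the triangle inequality makes
    the refined sum the larger one. *)
Lemma varsum_split l f g : all_nonneg l -> L1 (L0sum l) -> L0nonneg f -> L0nonneg g ->
  L0sum l = f +' g -> exists l1 l2, [/\ all_nonneg l1, all_nonneg l2, L0sum l1 = f, L0sum l2 = g &
    L0le (W l) (W l1 +' W l2)].
Proof.
move=> l0 lL1 f0 g0 lE.
have fl : L0le f (L0sum l).
  by rewrite lE; apply/L0leP; move/L0nonnegP: g0 => g0; qe_with g0; qe_lra.
have [s [s1 s2 fs ls]] := riesz_split HB l0 f0 fl.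
have gs : L0sum (map snd s) = g.
  have /L0eqP H : f +' L0sum (map snd s) = f +' g by rewrite fs -L0sum_pairs // -ls lE -fs.
  by apply/L0eqP; qe_with H; qe_lra.
exists (map fst s), (map snd s); split => //.
rewrite {1}ls; apply: varsum_pairs; apply: all_L1_sum => //.
  rewrite -fs; apply: (L1_le_nonneg Hm f0 _ lL1); rewrite lE.
  by apply/L0leP; move/L0nonnegP: g0 => g0; qe_with g0; qe_lra.
rewrite gs; apply: (L1_le_nonneg Hm g0 _ lL1); rewrite lE.
by apply/L0leP; move/L0nonnegP: f0 => f0; qe_with f0; qe_lra.
Qed.

(** A common refinement: split [l2] along the head [f] of [l1]. The piece summing to [f] dominates
    [|T f|], and the other piece is compared with the tail. *)
Lemma varsum_directed l1 l2 : all_nonneg l1 -> all_nonneg l2 -> L1 (L0sum l2) ->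
  L0sum l2 = L0sum l1 ->
  exists l3, [/\ all_nonneg l3, L0sum l3 = L0sum l1, L0le (W l1) (W l3) & L0le (W l2) (W l3)].
Proof.
elim: l1 l2 => [|f l1 IH] l2.
  move=> _ l20 _ E; exists l2; split => //; exact: (varsum_nonneg l2).
move=> /= [f0 l10] l20 l2L1 E; have s0 := L0sum_nonneg HB l10.
have [a [r [a0 r0 aE rE l2W]]] := varsum_split l20 l2L1 f0 s0 E.
have [aL1 rL1] : L1 (L0sum a) /\ L1 (L0sum r).
  rewrite aE rE; have /= [fL1 l1L1] : all_L1 (f :: l1) by apply: all_L1_sum => //=; rewrite -E.
  by split => //; exact: L1_sum.
have [l3 [l30 l3E l13 r3]] := IH r l10 r0 rL1 rE.
exists (a ++ l3); split.
- exact: all_nonneg_cat.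
- by rewrite L0sum_cat // aE l3E.
- rewrite varsum_cat; apply: (L0le_add HB) => //.
  by rewrite -aE; apply: abs_T_sum; exact: all_L1_sum.
- rewrite varsum_cat; apply: L0le_trans l2W _.
  exact: (L0le_add HB (L0le_refl _)).
Qed.

Definition is_modulus f t : Prop := [/\ L0nonneg t,
  (forall l, all_nonneg l -> L0sum l = f -> L0le (W l) t) &
  (forall u, (forall l, all_nonneg l -> L0sum l = f -> L0le (W l) u) -> L0le t u)].

Lemma is_modulus_uniq f t t' : is_modulus f t -> is_modulus f t' -> t = t'.
Proof. by move=> [_ H1 H2] [_ H1' H2']; apply: L0le_anti; [exact: H2|exact: H2']. Qed.

Lemma is_modulus_ex f b : L0nonneg f -> L1 f -> int f b ->
  exists t, is_modulus f t /\ exists2 a, int t a & aele mu a (fun w => c w * b w).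
Proof.
move=> f0 f1 ib.
pose F := [set W l | l in [set l | all_nonneg l /\ L0sum l = f]].
have mcb : L0O (fun w => c w * b w) by apply: measurable_funM => //; exact: int_meas ib.
have [||||t [t0 tub tlub ta]] := levi HB Hm (F := F) _ _ _ mcb.
- exists (W [:: f]); exists [:: f] => //=; split => //.
  by rewrite L0addC // L0add0.
- by move=> _ [l _ <-]; exact: varsum_nonneg.
- move=> _ _ [l1 [l10 l1E] <-] [l2 [l20 l2E] <-].
  have [||l3 [l30 l3E l13 l23]] := varsum_directed l10 l20; rewrite ?l2E ?l1E //.
  exists (W l3); split => //; exists l3 => //; split => //.
  by rewrite l3E.
- move=> _ [l [l0 lE] <-]; apply: int_varsum => //; last by rewrite lE.
  by apply: all_L1_sum => //; rewrite lE.
exists t; split => //; split => // [l l0 lE|u H]; first by apply: tub; exists l.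
by apply: tlub => _ [l [l0 lE] <-]; exact: H.
Qed.

Definition modpos f : L0n R B := L0_choose (is_modulus f) f.

Lemma modposP f : L0nonneg f -> L1 f -> is_modulus f (modpos f).
Proof.
move=> f0 f1; have [b ib] := L1_int f0 f1; have [t [tP _]] := is_modulus_ex f0 f1 ib.
by apply: L0chooseP; exists t.
Qed.

Lemma modpos_int f b : L0nonneg f -> L1 f -> int f b ->
  exists2 a, int (modpos f) a & aele mu a (fun w => c w * b w).
Proof.
move=> f0 f1 ib; have [t [tP ta]] := is_modulus_ex f0 f1 ib.
by rewrite -(is_modulus_uniq tP (modposP f0 f1)).
Qed.

Lemma modpos_nonneg f : L0nonneg f -> L1 f -> L0nonneg (modpos f).
Proof. by move=> f0 f1; have [] := modposP f0 f1. Qed.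

Lemma modpos_L1 f : L0nonneg f -> L1 f -> L1 (modpos f).
Proof.
move=> f0 f1; have [b ib] := L1_int f0 f1; have [a ia _] := modpos_int f0 f1 ib.
by apply: int_L1 ia; exact: modpos_nonneg.
Qed.

(** One inequality splits decompositions of [f + g]; the other concatenates decompositions of [f]
    and [g] and takes the suprema successively. *)
Lemma modpos_add f g : L0nonneg f -> L1 f -> L0nonneg g -> L1 g ->
  modpos (f +' g) = modpos f +' modpos g.
Proof.
move=> f0 f1 g0 g1.
have fg0 := L0add_nonneg HB f0 g0; have fg1 := L1_add HB Hm f1 g1.
apply: (is_modulus_uniq (modposP fg0 fg1)).
have [t0 tub tlub] := modposP f0 f1; have [t0' tub' tlub'] := modposP g0 g1.
split; first exact: L0add_nonneg.
  move=> l l0 lE; have lL1 : L1 (L0sum l) by rewrite lE.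
  have [l1 [l2 [l10 l20 l1E l2E H]]] := varsum_split l0 lL1 f0 g0 lE.
  apply: L0le_trans H _; apply: (L0le_add HB); [exact: tub|exact: tub'].
move=> u H.
have H1 l2 : all_nonneg l2 -> L0sum l2 = g -> L0le (W l2) (L0sub u (modpos f)).
  move=> l20 l2E; have /L0leP h : L0le (modpos f) (L0sub u (W l2)).
    apply: tlub => l1 l10 l1E; have /L0leP h : L0le (W (l1 ++ l2)) u.
      by apply: H; [exact: all_nonneg_cat|rewrite L0sum_cat // l1E l2E].
    by rewrite varsum_cat in h; apply/L0leP; rewrite /L0sub; qe_with h; qe_lra.
  by apply/L0leP; move: h; rewrite /L0sub => h; qe_with h; qe_lra.
have /L0leP h := tlub' _ H1.
by apply/L0leP; move: h; rewrite /L0sub => h; qe_with h; qe_lra.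
Qed.

Lemma modpos_zero : modpos 0' = 0'.
Proof.
have z0 : L0nonneg 0' by move=> p /=.
have := modpos_add z0 (L1_zero Hm) z0 (L1_zero Hm); rewrite L0add0 // => /L0eqP H.
by apply/L0eqP; qe_with H; qe_lra.
Qed.

Lemma varsum_scale (r : R) l : 0 <= r -> all_L1 l ->
  W (map (L0scale r) l) = L0scale r (W l).
Proof.
move=> r0; elim: l => [_|f l IH /= [f1 l1]].
  by rewrite /W /=; apply/L0eqP; qe_expand; apply: qeE => p -> ->; rewrite mulr0.
move: (IH l1); rewrite /W /= => ->; rewrite Tscale // (L0abs_scale HB) ger0_norm //.
apply/L0eqP; generalize (map (fun h => L0abs (T h)) l) => l'; qe_expand.
by apply: qeE => p; intros; nra.
Qed.

Lemma L0sum_scale (r : R) l : L0sum (map (L0scale r) l) = L0scale r (L0sum l).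
Proof.
elim: l => [|f l IH] /=; first by apply/L0eqP; qe_expand; apply: qeE => p -> ->; rewrite mulr0.
by rewrite IH; apply/L0eqP; qe_expand; apply: qeE => p; intros; nra.
Qed.

Lemma all_nonneg_scale (r : R) l : 0 <= r -> all_nonneg l -> all_nonneg (map (L0scale r) l).
Proof.
by move=> r0; elim: l => //= f l IH [f0 /IH l0]; split => //; exact: L0scale_nonneg.
Qed.

Lemma L0scale_le (r : R) f g : 0 <= r -> L0le f g -> L0le (L0scale r f) (L0scale r g).
Proof.
move=> r0 /L0leP H; apply/L0leP; qe_with H; qe_expand.
by apply: qeE => p -> -> h; exact: ler_wpM2l.
Qed.

Lemma L0scaleA (r s : R) f : L0scale r (L0scale s f) = L0scale (r * s) f.
Proof. by apply/L0eqP; qe_expand; apply: qeE => p; intros; nra. Qed.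

Lemma L0scale1 f : L0scale 1 f = f.
Proof. by apply/L0eqP; qe_lra. Qed.

Lemma modpos_scale (r : R) f : 0 <= r -> L0nonneg f -> L1 f ->
  modpos (L0scale r f) = L0scale r (modpos f).
Proof.
rewrite le_eqVlt => /predU1P[<- f0 f1|].
  have E (h : L0n R B) : L0scale 0 h = 0' by apply/L0eqP; qe_lra.
  by rewrite !E modpos_zero.
(* This inequality for all positive scalars implies its converse, by applying it to the inverse
   scalar. *)
have main (r' : R) g : 0 < r' -> L0nonneg g -> L1 g ->
    L0le (L0scale r' (modpos g)) (modpos (L0scale r' g)).
  move=> r0 g0 g1; have [_ _ lub] := modposP g0 g1.
  have [_ ub _] := modposP (L0scale_nonneg HB (ltW r0) g0) (L1_scale HB Hm r' g1).
  have h : L0le (modpos g) (L0scale r'^-1 (modpos (L0scale r' g))).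
    apply: lub => l l0 lE.
    rewrite -[W l]L0scale1 -(mulVf (lt0r_neq0 r0)) -L0scaleA.
    apply: L0scale_le; first by rewrite invr_ge0 ltW.
    rewrite -varsum_scale ?ltW //; last by apply: all_L1_sum => //; rewrite lE.
    apply: ub; first by apply: all_nonneg_scale => //; exact: ltW.
    by rewrite L0sum_scale lE.
  have := L0scale_le (ltW r0) h.
  by rewrite L0scaleA mulfV ?lt0r_neq0 // L0scale1.
move=> r0 f0 f1; apply: L0le_anti; last exact: main.
have rV0 : 0 < r^-1 by rewrite invr_gt0.
have := main _ _ rV0 (L0scale_nonneg HB (ltW r0) f0) (L1_scale HB Hm r f1).
rewrite L0scaleA mulVf ?lt0r_neq0 // L0scale1 => /(L0scale_le (ltW r0)).
by rewrite L0scaleA mulfV ?lt0r_neq0 // L0scale1.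
Qed.

Lemma abs_T_le_modpos f g : L0nonneg f -> L1 f -> L0le (L0abs g) f -> L0le (L0abs (T g)) (modpos f).
Proof.
move=> f0 f1 gf; have g1 := L1_le Hm gf f1.
have [_ ub _] := modposP f0 f1.
have gp := L1_pos HB Hm g1; have gn := L1_neg HB Hm g1.
(* The positive part of [g], its negative part and [f - |g|] form a decomposition of [f]. *)
have /L0leP h : L0le (W [:: L0pos g; L0neg g; L0sub f (L0abs g)]) (modpos f).
  apply: ub => /=.
    by do !split; [exact: L0pos_nonneg|exact: L0neg_nonneg|exact: L0sub_nonneg].
  by rewrite /L0sum /=; apply/L0eqP; rewrite /L0pos /L0neg /L0sub; qe_lra.
have Tg : T g = L0sub (T (L0pos g)) (T (L0neg g)) by rewrite -T_sub // -(L0pos_neg HB).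
move: h; rewrite /W /L0sum /= Tg.
move: (T (L0pos g)) (T (L0neg g)) (T (L0sub _ _)) => t1 t2 t3 h.
by apply/L0leP; rewrite /L0sub; qe_with h; qe_lra.
Qed.

(* [|a| + |b| = max |a + b| |a - b|] turns the sum over a decomposition into a single [|T h|]. *)
Lemma varsum_le_bound f u : (forall g, L1 g -> L0le (L0abs g) f -> L0le (L0abs (T g)) u) ->
  forall l, all_nonneg l -> all_L1 l -> forall h, L1 h ->
  L0le (L0abs h +' L0sum l) f -> L0le (L0abs (T h) +' W l) u.
Proof.
move=> Hu; elim=> [_ _ h h1 hf|x l IH /= [x0 l0] [x1 l1] h h1 hf].
  rewrite /W /= L0addC // L0add0 //; apply: Hu => //.
  by apply: L0le_trans hf; rewrite /= L0addC // L0add0 //; exact: L0le_refl.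
have /L0leP Hp : L0le (L0abs (T (h +' x)) +' W l) u.
  apply: IH => //; first exact: (L1_add HB Hm).
  apply: L0le_trans hf; apply/L0leP; move/L0nonnegP: x0 => x0; qe_with x0; qe_lra.
have /L0leP Hn : L0le (L0abs (T (L0sub h x)) +' W l) u.
  apply: IH => //; first exact: (L1_sub HB Hm).
  apply: L0le_trans hf; apply/L0leP; move/L0nonnegP: x0 => x0; rewrite /L0sub; qe_with x0; qe_lra.
move: Hp Hn; rewrite Tadd // T_sub // /L0sub /W /=.
move: (T h) (T x) (L0sum (map _ l)) => t1 t2 s Hp Hn.
by apply/L0leP; qe_with Hp; qe_with Hn; qe_lra.
Qed.

Lemma modpos_lub f : L0nonneg f -> L1 f ->
  L1_lub mu m [set L0abs (T g) | g in [set g | L1 g /\ L0le (L0abs g) f]] (modpos f).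
Proof.
move=> f0 f1; split; first exact: modpos_L1.
  by move=> _ [g [g1 gf] <-]; exact: abs_T_le_modpos.
move=> u u1 Hu; have [_ _ lub] := modposP f0 f1; apply: lub => l l0 lE.
have z0 : L0nonneg 0' by move=> p /=.
have := @varsum_le_bound f u _ l l0 _ 0' (L1_zero Hm) _.
rewrite T_zero (L0abs_id z0) !L0add0 // lE; apply.
- by move=> g g1 gf; apply: Hu; exists g.
- by apply: all_L1_sum => //; rewrite lE.
- exact: L0le_refl.
Qed.

Definition modulus f : L0n R B := L0sub (modpos (L0pos f)) (modpos (L0neg f)).

(** Additivity on the cone makes the value independent of the way [f] is written as a difference:
    apply it to [f^+ + h = g + f^-]. *)
Lemma modulus_diff f g h : L0nonneg g -> L1 g -> L0nonneg h -> L1 h -> f = L0sub g h ->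
  modulus f = L0sub (modpos g) (modpos h).
Proof.
move=> g0 g1 h0 h1 fE; have f1 : L1 f by rewrite fE; exact: (L1_sub HB Hm).
have fp0 := L0pos_nonneg HB f; have fn0 := L0neg_nonneg HB f.
have fp1 := L1_pos HB Hm f1; have fn1 := L1_neg HB Hm f1.
have E : L0pos f +' h = g +' L0neg f.
  apply/L0eqP; rewrite fE /L0pos /L0neg /L0sub; qe_lra.
have := congr1 modpos E; rewrite !modpos_add // => /L0eqP H.
by apply/L0eqP; rewrite /modulus /L0sub; qe_with H; qe_lra.
Qed.

Lemma modulus_nonneg f : L0nonneg f -> L1 f -> modulus f = modpos f.
Proof.
move=> f0 f1; have z0 : L0nonneg 0' by move=> p /=.
rewrite (modulus_diff f0 f1 z0 (L1_zero Hm)).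
  by rewrite modpos_zero; apply/L0eqP; rewrite /L0sub; qe_lra.
by apply/L0eqP; rewrite /L0sub; qe_lra.
Qed.

Lemma modulus_L1 f : L1 f -> L1 (modulus f).
Proof.
move=> f1; apply: (L1_sub HB Hm); apply: modpos_L1.
- exact: L0pos_nonneg.
- exact: (L1_pos HB Hm).
- exact: L0neg_nonneg.
- exact: (L1_neg HB Hm).
Qed.

Lemma modulus_add f g : L1 f -> L1 g -> modulus (f +' g) = modulus f +' modulus g.
Proof.
move=> f1 g1.
have fp0 := L0pos_nonneg HB f; have fn0 := L0neg_nonneg HB f.
have fp1 := L1_pos HB Hm f1; have fn1 := L1_neg HB Hm f1.
have gp0 := L0pos_nonneg HB g; have gn0 := L0neg_nonneg HB g.
have gp1 := L1_pos HB Hm g1; have gn1 := L1_neg HB Hm g1.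
rewrite (modulus_diff (L0add_nonneg HB fp0 gp0) (L1_add HB Hm fp1 gp1)
  (L0add_nonneg HB fn0 gn0) (L1_add HB Hm fn1 gn1)).
  by rewrite !modpos_add //; apply/L0eqP; rewrite /modulus /L0sub; qe_lra.
by apply/L0eqP; rewrite /L0pos /L0neg /L0sub; qe_lra.
Qed.

Lemma modulus_scale (r : R) f : L1 f -> modulus (L0scale r f) = L0scale r (modulus f).
Proof.
move=> f1.
have fp0 := L0pos_nonneg HB f; have fn0 := L0neg_nonneg HB f.
have fp1 := L1_pos HB Hm f1; have fn1 := L1_neg HB Hm f1.
have fE := L0pos_neg HB f.
have [r0|/ltW r0] := leP 0 r.
  rewrite (modulus_diff (L0scale_nonneg HB r0 fp0) (L1_scale HB Hm r fp1)
    (L0scale_nonneg HB r0 fn0) (L1_scale HB Hm r fn1)).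
    rewrite (modpos_scale r0 fp0 fp1) (modpos_scale r0 fn0 fn1); apply/L0eqP; rewrite /modulus /L0sub; qe_expand.
    by apply: qeE => p; intros; nra.
  rewrite {1}fE; apply/L0eqP; rewrite /L0sub.
  move: (L0pos f) (L0neg f) => f' f''; qe_expand; by apply: qeE => p; intros; nra.
have {}r0 : 0 <= - r by rewrite oppr_ge0.
rewrite (modulus_diff (L0scale_nonneg HB r0 fn0) (L1_scale HB Hm (-r) fn1)
  (L0scale_nonneg HB r0 fp0) (L1_scale HB Hm (-r) fp1)).
  rewrite (modpos_scale r0 fp0 fp1) (modpos_scale r0 fn0 fn1); apply/L0eqP; rewrite /modulus /L0sub; qe_expand.
  by apply: qeE => p; intros; nra.
rewrite {1}fE; apply/L0eqP; rewrite /L0sub.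
move: (L0pos f) (L0neg f) => f' f''; qe_expand; by apply: qeE => p; intros; nra.
Qed.

Lemma abs_modulus_le f : L1 f -> L0le (L0abs (modulus f)) (modpos (L0abs f)).
Proof.
move=> f1; have fp0 := L0pos_nonneg HB f; have fn0 := L0neg_nonneg HB f.
have fp1 := L1_pos HB Hm f1; have fn1 := L1_neg HB Hm f1.
rewrite (L0abs_pos_neg HB f) modpos_add // /modulus.
have /L0nonnegP h1 := modpos_nonneg fp0 fp1; have /L0nonnegP h2 := modpos_nonneg fn0 fn1.
by apply/L0leP; rewrite /L0sub; qe_with h1; qe_with h2; qe_lra.
Qed.

Lemma modulus_bound f : L1 f -> forall a b,
  int (L0abs (modulus f)) a -> int (L0abs f) b -> aele mu a (fun w => c w * b w).
Proof.
move=> f1 a b ia ib; have [a' ia' ab'] := modpos_int (L0abs_nonneg f) (L1_abs f1) ib.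
have h := int_le Hm (L0abs_nonneg _) (abs_modulus_le f1) ia ia'.
by ae_with h; ae_with ab'; apply: aeW => w h1 h2; exact: le_trans h1.
Qed.

End Modulus.

(** * Operator norms *)

Section OperatorNorm.
Context (R : realType) (d : measure_display) (Om : measurableType d)
        (mu : {finite_measure set Om -> \bar R}).
Context {disp : Order.disp_t} (B : ctbDistrLatticeType disp) (m : B -> Om -> R).
Hypothesis HB : complete_BA B.
Hypothesis Hm : L0_measure mu m.
Implicit Types (f g h : L0n R B) (x e : B) (E : set Om).
Local Notation int := (int_rel mu m).
Local Notation L1 := (inL1 mu m).

Lemma m_mono x e : (x <= e)%O -> aele mu (m x) (m e).
Proof.
move=> /meet_idPr xe; ae_with (m_split Hm e x); ae_with (m_ge0 Hm (Order.meet e (Order.compl x))).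
by apply: aeW => w; rewrite xe; lra.
Qed.

(* [e] is the image of [E] under the embedding of the measure algebra of Omega into nabla
   that d-decomposability provides. *)
Lemma band_elt E : measurable E -> exists e,
  (forall x, {ae mu, forall w, ~ E w -> m (Order.meet x e) w = 0}) /\
  (forall x, {ae mu, forall w, E w -> m (Order.meet x (Order.compl e)) w = 0}).
Proof.
move=> mE; have [_ _ _ _ [_ dec]] := Hm.
have m1 (A : set Om) : measurable A -> L0O (fun w => \1_A w * m \top%O w).
  by move=> mA; apply: measurable_funM; [exact: measurable_indic|exact: (m_meas Hm)].
have pos (A : set Om) : aele mu (fun=> 0) (fun w => \1_A w * m \top%O w).
  by ae_with (m_ge0 Hm \top%O); apply: aeW => w h; rewrite mulr_ge0.
have [||||||e1 [e2 [etop me1 me2]]] := dec \top%O (fun w => \1_E w * m \top%O w)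
    (fun w => \1_(~` E) w * m \top%O w).
- exact: m1.
- by apply: m1; exact: measurableC.
- exact: pos.
- exact: pos.
- ae_with (m_ge0 Hm \top%O); apply: aeW => w h; rewrite !indicE in_setC.
  by case: (w \in E); rewrite /= mul1r mul0r; [rewrite min_r|rewrite min_l].
- by apply: aeW => w; rewrite !indicE in_setC; case: (w \in E); rewrite /= mul1r mul0r ?addr0 ?add0r.
(* [d]-decomposability does not state that [e1] and [e2] are disjoint; that the complement of [e1]
   lies in [e2] is enough. *)
have ce1 : (Order.compl e1 <= e2)%O.
  by rewrite -[e2]complK; apply: meet_le_bot_compl; rewrite -complU -etop compl1.
exists e1; split => x.
  ae_with (m_mono (leIr e1 x)); ae_with me1; ae_with (m_ge0 Hm (Order.meet x e1)).
  apply: aeW => w h1 h2 h3 nE; apply/eqP; rewrite eq_le h1 andbT.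
  by rewrite (le_trans h3) // h2 indicE memNset // mul0r.
ae_with (m_mono (le_trans (leIr _ x) ce1)); ae_with me2.
ae_with (m_ge0 Hm (Order.meet x (Order.compl e1))).
apply: aeW => w h1 h2 h3 nE; apply/eqP; rewrite eq_le h1 andbT.
by rewrite (le_trans h3) // h2 indicE in_setC mem_set // mul0r.
Qed.

(** A simple function below [h] is nonpositive off [e], while inside [e] the measure lives on [E].
    So its integral is at most 0 off [E], and at most [b] everywhere because [h <= g]. *)
Lemma int_restrict e E g b h : measurable E ->
  (forall x, {ae mu, forall w, ~ E w -> m (Order.meet x e) w = 0}) ->
  L0nonneg g -> L0nonneg h -> int g b -> qe (fun p => v h p = ind R e p * v g p) ->
  exists2 a, int h a & aele mu a (fun w => \1_E w * b w).
Proof.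
move=> mE eE g0 h0 ib hE; apply: (int_exists Hm) => //.
  by apply: measurable_funM; [exact: measurable_indic|exact: int_meas ib].
move=> l lh; have hg : L0le h g.
  apply/L0leP; move/L0nonnegP: g0 => g0; qe_with g0; qe_with hE; apply: qeE => p -> g0'.
  by rewrite /ind; case: pselect => ?; rewrite ?mul1r ?mul0r.
have Hb := int_ub Hm g0 ib (L0le_trans lh hg).
have Hc : aele mu (fun=> 0) (fun w => 0 * m (Order.compl e) w +
    loc_int m (Order.compl e) (lscale (-1) l) w).
  apply: (loc_int_ge0 Hm) => p ep; rewrite Sfun_scale add0r mulN1r oppr_ge0.
  have : ((Sfun l p)%:E <= (0%R : R)%:E)%E.
    apply: (@L0le_local _ _ _ (Order.compl e) (L0simple l) (L0cst B 0)) => //.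
    move/belowP: lh => lh; qe_with lh; qe_with hE; apply: qeE => q h1 h2 /UbaseC eq.
    by rewrite L0val_cst L0val_simple; apply: le_trans h2 _; rewrite h1 ind0 // mul0r.
  by rewrite lee_fin.
have Ho : {ae mu, forall w, ~ E w -> loc_int m e l w = 0}.
  rewrite /loc_int; elim: l {lh Hb Hc} => [|y l IH]; first by apply: aeW => w; rewrite big_nil.
  ae_with IH; ae_with (eE y.2); apply: aeW => w h1 h2 nE.
  by rewrite big_cons h1 // h2 // mulr0 addr0.
ae_with Hb; ae_with Hc; ae_with Ho; ae_with (loc_int_split Hm \top%O e l).
apply: aeW => w; rewrite loc_int_top !meet1x => -> h1 h2 h3.
have [Ew|nEw] := pselect (E w); first by rewrite indicE mem_set // mul1r.
rewrite indicE memNset // mul0r h1 // add0r; move: h2; rewrite mul0r add0r /loc_int big_map /=.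
by under eq_bigr do rewrite mulN1r mulNr; rewrite sumrN oppr_ge0.
Qed.

Variables (T : L0n R B -> L0n R B) (c : Om -> R).
Hypothesis TL1 : forall f, L1 f -> L1 (T f).
Hypothesis Tadd : forall f g, L1 f -> L1 g -> T (L0add f g) = L0add (T f) (T g).
Hypothesis Tscale : forall (r : R) f, L1 f -> T (L0scale r f) = L0scale r (T f).
Hypothesis mc : L0O c.
Hypothesis Tbound : forall f, L1 f -> forall a b,
  int (L0abs (T f)) a -> int (L0abs f) b -> aele mu a (fun w => c w * b w).

Lemma norm1_le1_zero : norm1_le1 mu m (@L0cst R _ B 0).
Proof.
have z0 : L0nonneg (@L0cst R _ B 0) by move=> p /=.
move=> b; rewrite (L0abs_id z0) => ib; ae_with (int_uniq ib (int0 Hm)).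
by apply: aeW => w ->.
Qed.

Lemma int_abs_T_zero : int (L0abs (T (L0cst B 0))) (fun=> 0).
Proof.
have z0 : L0nonneg (@L0cst R _ B 0) by move=> p /=.
by rewrite (T_zero HB Hm Tscale) (L0abs_id z0); exact: int0.
Qed.

Lemma opnorm_exists : exists k, opnorm_rel mu m T k.
Proof.
(* [c] carries no sign; [Num.max (c w) 0] bounds [c w * b w] whenever [0 <= b w <= 1]. *)
apply: (@L0O_dedekind_complete _ _ _ mu _ (fun w => Num.max (c w) 0)).
- exists (fun=> 0), (L0cst B 0); split; [exact: L1_zero|exact: norm1_le1_zero|].
  exact: int_abs_T_zero.
- by move=> a [f [_ _ /int_meas]].
- by apply: measurable_maxr => //; exact: measurable_cst.
- move=> a [f [f1 fle ia]]; have [b ib] := f1.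
  ae_with (Tbound f1 ia ib); ae_with (fle _ ib); ae_with (int_ge0 Hm (L0abs_nonneg f) ib).
  apply: aeW => w b0 b1 h; apply: le_trans h _; rewrite le_max.
  have [c0|c0] := leP 0 (c w); first by rewrite ler_piMr.
  by rewrite mulr_le0_ge0 ?orbT // ltW.
Qed.

Variable k : Om -> R.
Hypothesis kP : opnorm_rel mu m T k.

Lemma opnorm_ge0 : aele mu (fun=> 0) k.
Proof.
have [_ ub _] := kP; apply: ub; exists (L0cst B 0).
by split; [exact: L1_zero|exact: norm1_le1_zero|exact: int_abs_T_zero].
Qed.

(* On the set where [|g|_1 <= r] the operator acts as on [r] times the unit ball. *)
Lemma opnorm_bound_level g a b (r : R) : 0 < r -> L1 g -> int (L0abs (T g)) a -> int (L0abs g) b ->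
  {ae mu, forall w, b w <= r -> a w <= k w * r}.
Proof.
move=> r0 g1 ia ib; pose E := [set w | b w <= r].
have mE : measurable E.
  rewrite (_ : E = ~` [set w | r < b w]); first exact/measurableC/superlevel_measurable/(int_meas ib).
  by apply/seteqP; split => w /=; rewrite /E /= leNgt => /negP.
have [e [eE ceE]] := band_elt mE.
have [g' g'E] := L0restrict_ex HB e g; have [g'' g''E] := L0restrict_ex HB (Order.compl e) g.
have absE x (h : L0n R B) : qe (fun p => v h p = ind R x p * v g p) ->
    qe (fun p => v (L0abs h) p = ind R x p * v (L0abs g) p).
  move=> H; qe_with H; apply: qeE => p hp; rewrite !L0val_abs hp normrM.
  by congr (_ * _); rewrite /ind; case: pselect => ?; rewrite ?normr1 ?normr0.
have [b' ib' b'le] := int_restrict mE eE (L0abs_nonneg g) (L0abs_nonneg g') ib (absE _ _ g'E).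
have ceE' x : {ae mu, forall w, ~ (~` E) w -> m (Order.meet x (Order.compl e)) w = 0}.
  by ae_with (ceE x); apply: aeW => w h /contrapT.
have [b'' ib'' b''le] := int_restrict (measurableC mE) ceE' (L0abs_nonneg g) (L0abs_nonneg g'')
  ib (absE _ _ g''E).
have g'1 : L1 g' by exists b'.
have g''1 : L1 g'' by exists b''.
have gE : g = L0add g' g''.
  apply/L0eqP; qe_with g'E; qe_with g''E; qe_expand; apply: qeE => p -> -> ->.
  have [ep|ep] := pselect (Ubase e p).
    by rewrite ind1 // ind0 ?mul1r ?mul0r ?addr0 // => /UbaseC.
  by rewrite ind0 // ind1 ?mul1r ?mul0r ?add0r //; apply/UbaseC.
have [a' ia'] := TL1 g'1; have [a'' ia''] := TL1 g''1.
have Ha : aele mu a (fun w => a' w + a'' w).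
  have := int_add HB Hm (L0abs_nonneg _) (L0abs_nonneg _) ia' ia''.
  apply: (int_le Hm (L0abs_nonneg _) _ ia).
  by rewrite {1}gE Tadd //; exact: L0abs_add.
have rV0 : 0 <= r^-1 by rewrite invr_ge0 ltW.
have b0 := int_ge0 Hm (L0abs_nonneg g) ib.
have Hk : aele mu (fun w => r^-1 * a' w) k.
  (* [g'] has norm at most [r] on [E] and 0 off [E], so dividing by [r] brings it into the unit
     ball. *)
  have [_ ub _] := kP; apply: ub; exists (L0scale r^-1 g'); split.
  - exact: (L1_scale HB Hm).
  - move=> b1; rewrite (L0abs_scale HB) ger0_norm // => ib1.
    ae_with (int_uniq ib1 (int_scale HB Hm rV0 (L0abs_nonneg g') ib')); ae_with b'le; ae_with b0.
    apply: aeW => w b0' h1 ->; rewrite mulrC ler_pdivrMr // mul1r; apply: le_trans h1 _.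
    rewrite indicE; have [Ew|nEw] := pselect (E w); first by rewrite mem_set // mul1r.
    by rewrite memNset // mul0r ltW.
  - rewrite Tscale // (L0abs_scale HB) ger0_norm //.
    exact: (int_scale HB Hm rV0 (L0abs_nonneg _) ia').
ae_with Ha; ae_with Hk; ae_with (Tbound g''1 ia'' ib''); ae_with b''le.
ae_with (int_ge0 Hm (L0abs_nonneg g'') ib'').
apply: aeW => w b''0 h1 h2 h3 h4 Ew.
(* On [E] the norm of [g''] vanishes, and the crude bound [c] makes that of [T g''] vanish too; only
   [g'] contributes to [a]. *)
have b''E : b'' w = 0.
  by apply/eqP; rewrite eq_le b''0 andbT (le_trans h1) // indicE in_setC mem_set // mul0r.
move: h2; rewrite b''E mulr0 => h2; apply: le_trans h4 _.
by move: h3; rewrite mulrC ler_pdivrMr //; lra.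
Qed.

(** Let [r] decrease to [b w] through the rationals. Where [k w = 0], one rational above [b w] is
    enough; elsewhere a violation leaves room for a rational between [b w] and [a w / k w]. *)
Lemma opnorm_bound g a b : L1 g -> int (L0abs (T g)) a -> int (L0abs g) b ->
  aele mu a (fun w => k w * b w).
Proof.
move=> g1 ia ib.
have : {ae mu, forall w, forall q : rat, 0 < ratr q :> R -> b w <= ratr q -> a w <= k w * ratr q}.
  apply: ae_rat => q; have [q0|q0] := boolP (0 < ratr q :> R); last exact: aeW.
  by ae_with (opnorm_bound_level q0 g1 ia ib); apply: aeW.
move=> H; ae_with H; ae_with opnorm_ge0; ae_with (int_ge0 Hm (L0abs_nonneg g) ib).
apply: aeW => w b0 k0 Hw; rewrite leNgt; apply/negP => kba.
have [k00|kpos] := leP (k w) 0.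
  have kE : k w = 0 by apply/eqP; rewrite eq_le k00.
  have : b w < b w + 1 by rewrite ltrDl.
  move=> /rat_in_itvoo[q /itvP qi].
  have := Hw q (le_lt_trans b0 (_ : b w < _)); rewrite qi => /(_ isT) /(_ (ltW _)).
  by rewrite qi kE mul0r => /(_ isT); move: kba; rewrite kE mul0r ltNge => /negP.
have : b w < a w / k w by rewrite ltr_pdivlMr // mulrC.
move=> /rat_in_itvoo[q /itvP qi].
have bq : b w < ratr q by rewrite qi.
have := Hw q (le_lt_trans b0 bq) (ltW bq); apply/negP; rewrite -ltNge.
by rewrite mulrC -ltr_pdivlMr // qi.
Qed.
End OperatorNorm.

(** * The sup norm of the modulus *)

Section SupNorm.
Context (R : realType) {disp : Order.disp_t} (B : ctbDistrLatticeType disp).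
Hypothesis HB : complete_BA B.
Implicit Types (f g : L0n R B).

Lemma norminf_ge f p : (`|proj1_sig f p| <= norminf f)%E.
Proof. by apply: le_ereal_inf_tmp => _ [lam [_ H] <-]; exact: H. Qed.

Lemma norminf_le f (lam : R) : 0 <= lam -> (forall p, `|proj1_sig f p| <= lam%:E)%E ->
  (norminf f <= lam%:E)%E.
Proof. by move=> lam0 H; apply: ereal_inf_lbound; exists lam. Qed.

Lemma norminf_ge0 f : (0 <= norminf f)%E.
Proof. by apply: le_ereal_inf_tmp => _ [lam [lam0 _] <-]; rewrite lee_fin. Qed.

Lemma norminf_mono f g : (forall p, `|proj1_sig f p| <= `|proj1_sig g p|)%E ->
  (norminf f <= norminf g)%E.
Proof.
move=> fg; apply: ereal_inf_le_tmp => _ [lam [lam0 H] <-]; exists lam => //; split => // p.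
exact: le_trans (fg p) (H p).
Qed.

(* Compactness of the Stone space: the sets containing some [{|f| > n}] form a filter. *)
Lemma inLinf_bounded f : inLinf f -> exists2 lam : R, 0 <= lam &
  forall p, (`|proj1_sig f p| <= lam%:E)%E.
Proof.
move=> fin_f; apply: contrapT => unb.
pose F := [set x : B | exists n : nat, forall p,
  ((n%:R : R)%:E < proj1_sig (L0abs f) p)%E -> Ubase x p].
have [] := @proper_filter_ultra _ _ F.
  split.
  - move=> [n H]; apply: unb; exists n%:R => // p; rewrite -L0absE leNgt.
    by apply/negP => /H /Ubase0.
  - by exists 0%N => p _; exact: Ubase1.
  - by move=> x y [n H] xy; exists n => p /H; exact: UbaseS.
  - move=> x y [n Hx] [n' Hy]; exists (maxn n n') => p h; apply/UbaseI.
    have le_max_lt (i : nat) : (i <= maxn n n')%N -> ((i%:R : R)%:E < proj1_sig (L0abs f) p)%E.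
      by move=> ile; apply: le_lt_trans h; rewrite lee_fin ler_nat.
    by split; [apply/Hx/le_max_lt/leq_maxl|apply/Hy/le_max_lt/leq_maxr].
move=> p Fp.
have H n : ((n%:R : R)%:E <= `|proj1_sig f p|)%E.
  (* [p] lies in every element containing [{|f| > n}], in particular in this one, on which
     [|f| >= n]. *)
  have [e eP] := level_elt HB (L0abs f) n%:R.
  by rewrite -L0absE; apply: (eP p).2; apply: Fp; exists n => q /(eP q).1.
have := fin_f p; case: (proj1_sig f p) H => [r| |] //= H _.
have := H (Num.truncn `|r|).+1; rewrite lee_fin leNgt.
by rewrite truncnS_gt.
Qed.
End SupNorm.

Section ModulusSupNorm.
Context (R : realType) (d : measure_display) (Om : measurableType d)
        (mu : {finite_measure set Om -> \bar R}).
Context {disp : Order.disp_t} (B : ctbDistrLatticeType disp) (m : B -> Om -> R).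
Hypothesis HB : complete_BA B.
Hypothesis Hm : L0_measure mu m.
Implicit Types (f g h : L0n R B).
Local Notation int := (int_rel mu m).
Local Notation L1 := (inL1 mu m).

Variables (T : L0n R B -> L0n R B) (c : Om -> R).
Hypothesis TL1 : forall f, L1 f -> L1 (T f).
Hypothesis Tadd : forall f g, L1 f -> L1 g -> T (L0add f g) = L0add (T f) (T g).
Hypothesis Tscale : forall (r : R) f, L1 f -> T (L0scale r f) = L0scale r (T f).
Hypothesis mc : L0O c.
Hypothesis Tbound : forall f, L1 f -> forall a b,
  int (L0abs (T f)) a -> int (L0abs f) b -> aele mu a (fun w => c w * b w).
Local Notation A := (modulus T).

Lemma L1_bounded f (lam : R) : (forall p, `|proj1_sig f p| <= lam%:E)%E -> L1 f.
Proof.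
move=> H; apply: (int_cst_ex Hm (c := lam)); first exact: L0abs_nonneg.
by move=> p; rewrite L0absE.
Qed.

Lemma modpos_le f g : L0nonneg f -> L0le f g -> L1 g -> L0le (modpos T f) (modpos T g).
Proof.
move=> f0 fg g1; have f1 := L1_le_nonneg Hm f0 fg g1.
have s0 := L0sub_nonneg HB fg; have s1 := L1_sub HB Hm g1 f1.
rewrite -(L0subK HB g f) (modpos_add HB Hm TL1 Tadd Tscale mc Tbound f0 f1 s0 s1).
have /L0nonnegP h := modpos_nonneg HB Hm TL1 Tadd Tscale mc Tbound s0 s1.
by apply/L0leP; qe_with h; qe_lra.
Qed.

Hypothesis Tfin : (opnorminf T < +oo)%E.

Let zero_inf : inLinf (@L0cst R _ B 0). Proof. by move=> p. Qed.

Let norminf_zero : (norminf (@L0cst R _ B 0) <= 1)%E.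
Proof. by apply: norminf_le => // p /=; rewrite normr0 lee_fin. Qed.

Lemma opnorminf_fin : exists2 n : R, 0 <= n & opnorminf T = n%:E.
Proof.
have : (0 <= opnorminf T)%E.
  apply: le_trans (norminf_ge0 (T (L0cst B 0))) _.
  by apply: ereal_sup_ubound; exists (L0cst B 0).
by case: (opnorminf T) Tfin => [n| |] // _; rewrite lee_fin => n0; exists n.
Qed.

(** The form (c) reduces the claim to a single [T g] with [|g| <= 1], and such a [g] is in the unit
    ball of L_infty. *)
Lemma modpos_one_le (n : R) : 0 <= n -> opnorminf T = n%:E -> L0le (modpos T (L0cst B 1)) (L0cst B n).
Proof.
move=> n0 nE; have one0 : L0nonneg (@L0cst R _ B 1) by move=> p /=; rewrite lee_fin.
have one1 : L1 (L0cst B 1) by apply: (@L1_bounded _ 1) => p /=; rewrite normr1.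
have [_ _ lub] := modpos_lub HB Hm TL1 Tadd Tscale mc Tbound one0 one1.
apply: lub.
  by apply: (@L1_bounded _ n) => p /=; rewrite ger0_norm.
move=> _ [g [g1 gle] <-] p; rewrite L0absE.
apply: le_trans (norminf_ge _ _) _; rewrite /= -nE; apply: ereal_sup_ubound; exists g => //.
have gle' q : (`|proj1_sig g q| <= 1%:E)%E by have := gle q; rewrite L0absE.
split; last exact: norminf_le.
by move=> q; have := gle' q; case: (proj1_sig g q).
Qed.

Lemma modulus_bounded (n lam : R) f : 0 <= n -> opnorminf T = n%:E -> 0 <= lam ->
  (forall p, `|proj1_sig f p| <= lam%:E)%E -> forall p, (`|proj1_sig (A f) p| <= (lam * n)%:E)%E.
Proof.
move=> n0 nE lam0 flam p; rewrite -L0absE.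
have one0 : L0nonneg (@L0cst R _ B 1) by move=> q /=; rewrite lee_fin.
have one1 : L1 (L0cst B 1) by apply: (@L1_bounded _ 1) => q /=; rewrite normr1.
have lamE : L0cst B lam = L0scale lam (L0cst B 1).
  by apply/L0eqP; qe_expand; apply: qeE => q -> -> ->; rewrite mulr1.
have H1 := abs_modulus_le HB Hm TL1 Tadd Tscale mc Tbound (L1_bounded flam).
apply: le_trans (H1 p) _.
have lam1 : L1 (L0cst B lam) by apply: (@L1_bounded _ lam) => q /=; rewrite ger0_norm.
have flam' : L0le (L0abs f) (L0cst B lam) by move=> q; rewrite L0absE; exact: flam.
apply: le_trans (modpos_le (L0abs_nonneg f) flam' lam1 p) _.
rewrite lamE (modpos_scale HB Hm TL1 Tadd Tscale mc Tbound lam0 one0 one1).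
apply: le_trans (L0scale_le HB lam0 (modpos_one_le n0 nE) p) _.
have -> : L0scale lam (L0cst B n) = L0cst B (lam * n).
  by apply/L0eqP; qe_expand; apply: qeE => q -> -> ->.
by [].
Qed.

Lemma modulus_inLinf f : inLinf f -> inLinf (A f).
Proof.
move=> /(inLinf_bounded HB)[lam lam0 flam] p; have [n n0 nE] := opnorminf_fin.
by have := modulus_bounded n0 nE lam0 flam p; case: (proj1_sig (A f) p).
Qed.

Lemma opnorminf_modulus : opnorminf T = opnorminf A.
Proof.
have [n n0 nE] := opnorminf_fin.
apply/eqP; rewrite eq_le; apply/andP; split.
  apply: ge_ereal_sup => _ [f [finf f1] <-].
  (* Pass to [|f|], which has the same sup norm and satisfies [|T f| <= A |f|]. *)
  apply: (@le_trans _ _ (norminf (A (L0abs f)))).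
    apply: norminf_mono => p; rewrite -L0absE.
    have [lam lam0 flam] := inLinf_bounded HB finf.
    have fa0 := L0abs_nonneg f; have fa1 := L1_abs (L1_bounded flam).
    rewrite (modulus_nonneg HB Hm TL1 Tadd Tscale mc Tbound fa0 fa1).
    apply: le_trans (lee_abs _).
    exact: (abs_T_le_modpos HB Hm TL1 Tadd Tscale mc Tbound fa0 fa1 (L0le_refl _)).
  apply: ereal_sup_ubound; exists (L0abs f) => //; split.
    by move=> p; have := finf p; rewrite L0absE abse_fin_num.
  by apply: le_trans f1; apply: norminf_mono => p; rewrite L0absE abse_id.
apply: ge_ereal_sup => _ [f [finf f1] <-]; rewrite nE; apply: norminf_le => // p.
have := modulus_bounded n0 nE ler01 (fun q => le_trans (norminf_ge f q) f1) p.
by rewrite mul1r.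
Qed.
End ModulusSupNorm.

(** * Existence and uniqueness of the modulus, with both norm equalities *)

Theorem theorem3p1 (R : realType) (d : measure_display) (Om : measurableType d)
  (mu : {finite_measure set Om -> \bar R}) (Hmu : complete_measure mu)
  (disp : Order.disp_t) (B : ctbDistrLatticeType disp) (HB : complete_BA B)
  (m : B -> Om -> R) (Hm : L0_measure mu m)
  (T : L0n R B -> L0n R B) (HT : L0_bounded_linear mu m T) :
  exists A : L0n R B -> L0n R B,
    [/\ modulus_props mu m T A,
        (forall A', modulus_props mu m T A' -> forall f, inL1 mu m f -> A' f = A f) &
        ((forall f, inLinf f -> inLinf (T f)) -> (opnorminf T < +oo)%E ->
           (forall f, inLinf f -> inLinf (A f)) /\ opnorminf T = opnorminf A)].
Proof.
have [TL1 Tadd Tscale [c [mc Tc]]] := HT.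
have [k kP] := opnorm_exists HB Hm Tscale mc Tc.
have mk : L0O k by have [] := kP.
(* From here on the norm [k] itself serves as the bound of [T], so that the modulus inherits [k] and
   not merely [c]. *)
have Tk f : inL1 mu m f -> forall a b, int_rel mu m (L0abs (T f)) a ->
    int_rel mu m (L0abs f) b -> aele mu a (fun w => k w * b w).
  by move=> f1 a b; exact: (opnorm_bound HB Hm TL1 Tadd Tscale Tc kP f1).
have Ann := modulus_nonneg HB Hm TL1 Tadd Tscale mk Tk.
have Alub f : inL1 mu m f -> L0nonneg f ->
    L1_lub mu m [set L0abs (T g) | g in [set g | inL1 mu m g /\ L0le (L0abs g) f]] (modulus T f).
  by move=> f1 f0; rewrite Ann //; exact: (modpos_lub HB Hm TL1 Tadd Tscale mk Tk).
have Aabs f : inL1 mu m f -> L0le (L0abs (T f)) (modulus T (L0abs f)).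
  move=> f1; have [_ ub _] := Alub _ (L1_abs f1) (L0abs_nonneg f).
  by apply: ub; exists f => //; split => //; exact: L0le_refl.
have AL1 := modulus_L1 HB Hm TL1 Tadd Tscale mk Tk.
have Abound := modulus_bound HB Hm TL1 Tadd Tscale mk Tk.
exists (modulus T); split.
- split => //.
  + split => //.
    * exact: (modulus_add HB Hm TL1 Tadd Tscale mk Tk).
    * exact: (modulus_scale HB Hm TL1 Tadd Tscale mk Tk).
    * by exists k; split => // f f1 a b; exact: Abound.
  + exists k; split => //; have [_ _ klub] := kP; split => //.
      move=> a [f [f1 fle ia]]; have [b ib] := f1.
      ae_with (Abound f f1 a b ia ib); ae_with (fle b ib); ae_with (opnorm_ge0 HB Hm Tscale kP).
      by apply: aeW => w k0 b1 h; apply: le_trans h _; rewrite ler_piMr.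
    (* A bound for the modulus on the unit ball also bounds [T] there: replace [f] by [|f|], which
       has the same norm, and use (b). *)
    move=> u mu_ Hu; apply: klub => // a [f [f1 fle ia]].
    have absK : L0abs (L0abs f) = L0abs f by rewrite L0abs_id //; exact: L0abs_nonneg.
    have [a' ia'] := AL1 _ (L1_abs f1).
    have h1 : aele mu a' u.
      apply: Hu; exists (L0abs f); split => //; first exact: L1_abs.
      by move=> b; rewrite absK; exact: fle.
    have h2 : aele mu a a'.
      apply: (int_le Hm (L0abs_nonneg _) _ ia ia') => p.
      by apply: le_trans (Aabs f f1 p) _; rewrite L0absE lee_abs.
    by ae_with h1; ae_with h2; apply: aeW => w; exact: le_trans.
- move=> A' [[_ A'add A'scale _] _ _ A'lub] f f1.
  (* Property (c) determines the operator on the positive cone, and linearity determines it on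
     differences. *)
  have E g : inL1 mu m g -> L0nonneg g -> A' g = modulus T g.
    move=> g1 g0; have [u1 ub lub] := A'lub g g1 g0; have [u1' ub' lub'] := Alub g g1 g0.
    by apply: L0le_anti; [exact: lub|exact: lub'].
  have fp1 := L1_pos HB Hm f1; have fn1 := L1_neg HB Hm f1.
  have fp0 := L0pos_nonneg HB f; have fn0 := L0neg_nonneg HB f.
  rewrite {1}(L0pos_neg HB f) (A'add _ _ fp1 (L1_scale HB Hm _ fn1)) (A'scale _ _ fn1).
  by rewrite (E _ fp1 fp0) (E _ fn1 fn0) (Ann _ fp0 fp1) (Ann _ fn0 fn1).
- move=> Tinf Tfin; split.
    by move=> f; exact: (modulus_inLinf HB Hm TL1 Tadd Tscale mk Tk).
  exact: (opnorminf_modulus HB Hm TL1 Tadd Tscale mk Tk).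
Qed.
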